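(* Let $n\ge 1$ and let $\theta=(\theta_{jk})_{j,k=1,\dots,n}$ be a matrix with entries in the unit circle $\mathbb{T}$ such that $\theta_{kj}=\overline{\theta_{jk}}$ and $\theta_{jj}=1$ for all $j,k$. Let $v:\mathbb{Z}^n\to(0,\infty)$ be a submultiplicative and symmetric weight function, i.e., $v(x+y)\le v(x)v(y)$ and $v(-x)=v(x)$ for all $x,y\in\mathbb{Z}^n$. Then the Banach algebra $\ell^1_v(\mathbb{Z}^n,\theta)$ is inverse-closed in $C^*(\theta)$ if and only if $v$ satisfies the Gelfand-Raikov-Shilov condition (GRS-condition) $$\lim_{k\to\infty} v(kx)^{1/k}=1\qquad\text{for all } x\in\mathbb{Z}^n.$$
   Context: Define $\sigma:\mathbb{Z}^n\times\mathbb{Z}^n\to\mathbb{T}$ by $\sigma(l,m)=\prod_{1\le j<k\le n}\theta_{k,j}^{\,l_k m_j}$. For $f,g\in\ell^1(\mathbb{Z}^n)$ the twisted convolution is $(f\,\natural_\theta\, g)(x)=\sum_{y\in\mathbb{Z}^n} f(y)g(x-y)\sigma(y,x-y)$, and the involution is $f^*(x)=\overline{\sigma(x,-x)}\,\overline{f(-x)}$, $x\in\mathbb{Z}^n$. With these operations and the $\ell^1$-norm, $\ell^1(\mathbb{Z}^n)$ is a unital Banach $*$-algebra, denoted $\ell^1(\mathbb{Z}^n,\theta)$; its unit is $\delta_0$. For a weight $v$ as in the claim, $\ell^1_v(\mathbb{Z}^n)$ is the space of functions $f$ on $\mathbb{Z}^n$ with $\|f\|_{\ell^1_v}=\|fv\|_1=\sum_{x\in\mathbb{Z}^n}|f(x)|v(x)<\infty$.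 With the twisted convolution $\natural_\theta$ it is a Banach algebra, denoted $\ell^1_v(\mathbb{Z}^n,\theta)$, and it is a $*$-subalgebra of $\ell^1(\mathbb{Z}^n,\theta)$. The non-commutative torus $C^*(\theta)$ is the universal $C^*$-algebra generated by unitaries $U_1,\dots,U_n$ with $U_jU_k=\theta_{jk}U_kU_j$. It is the enveloping $C^*$-algebra of $\ell^1(\mathbb{Z}^n,\theta)$, and it is identified with the operator-norm closure of $\lambda(\ell^1(\mathbb{Z}^n))$ in the bounded operators on $\ell^2(\mathbb{Z}^n)$, where $\lambda(f)g=f\,\natural_\theta\, g$ for $f\in\ell^1(\mathbb{Z}^n)$, $g\in\ell^2(\mathbb{Z}^n)$ is the (faithful) regular representation. The algebras $\ell^1_v(\mathbb{Z}^n,\theta)\subseteq\ell^1(\mathbb{Z}^n,\theta)$ are regarded as subalgebras of $C^*(\theta)$ via $f\mapsto\lambda(f)$. Let $\mathcal{A}\subseteq\mathcal{B}$ be algebras with common identity. $\mathcal{A}$ is called inverse-closed in $\mathcal{B}$ if $a\in\mathcal{A}$ and $a^{-1}\in\mathcal{B}$ imply $a^{-1}\in\mathcal{A}$. *)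

(* Defs.v *)
From HB Require Import structures.
From mathcomp Require Import all_boot all_order all_algebra complex.
From mathcomp Require Import all_classical all_reals all_analysis.
From mathcomp Require Import ring.
Set Implicit Arguments.
Unset Strict Implicit.
Unset Printing Implicit Defensive.
Import Order.TTheory GRing.Theory Num.Theory.
Import numFieldNormedType.Exports Normc.
Local Open Scope classical_set_scope.
Local Open Scope ring_scope.

(* Sums of absolutely summable families; junk on all other families. *)
Definition rsum (R : realType) (I : choiceType) (f : I -> R) : R :=
  fine (\esum_(i in [set: I]) (f^\+ i)%:E)
  - fine (\esum_(i in [set: I]) (f^\- i)%:E).

Definition csum (R : realType) (I : choiceType) (f : I -> R[i]) : R[i] :=
  Complex (rsum (fun i => complex.Re (f i))) (rsum (fun i => complex.Im (f i))).

Definition ell1 (R : realType) (n : nat) : set ('rV[int]_n -> R[i]) :=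
  [set f | (\esum_(x in [set: 'rV[int]_n]) (normc (f x))%:E < +oo)%E].

Definition weighted_ell1 (R : realType) (n : nat) (v : 'rV[int]_n -> R) :
    set ('rV[int]_n -> R[i]) :=
  [set f | (\esum_(x in [set: 'rV[int]_n]) (normc (f x) * v x)%:E < +oo)%E].

Definition l2norm (R : realType) (n : nat) (g : 'rV[int]_n -> R[i]) : \bar R :=
  sqrte (\esum_(x in [set: 'rV[int]_n]) (normc (g x) ^+ 2)%:E).

Definition square_summable (R : realType) (n : nat) :
    {pred 'rV[int]_n -> R[i]} :=
  fun g => `[< (l2norm g < +oo)%E >].

Section ell2_submodule.
Variables (R : realType) (n : nat).
Implicit Types u w : 'rV[int]_n -> R[i].

Lemma square_summableE u : (u \in @square_summable R n) =
  (\esum_(x in [set: 'rV[int]_n]) (normc (u x) ^+ 2)%:E < +oo)%E.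
Proof.
rewrite -topredE /= /square_summable asboolb /l2norm.
by case: (\esum_(x in _) _)%E => [r| |] //=; rewrite ?ltry ?ltNyr.
Qed.

Lemma square_summable_submod : submod_closed (@square_summable R n).
Proof.
split=> [|a u w].
  by rewrite square_summableE esum1 ?ltry// => x _; rewrite normc0 expr0n.
rewrite !square_summableE => hu hw.
pose c : R := 2 * normc a ^+ 2.
have n0 (z : R[i]) : 0 <= normc z by case: z => ? ?; exact: sqrtr_ge0.
have c0 : 0 <= c by rewrite mulr_ge0 ?sqr_ge0.
have scale (k : R) (f : 'rV[int]_n -> R) : 0 <= k -> (forall x, 0 <= f x) ->
    (\esum_(x in [set: 'rV[int]_n]) (f x)%:E < +oo)%E ->
    (\esum_(x in [set: 'rV[int]_n]) (k * f x)%:E < +oo)%E.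
  move=> k0 f0 fy.
  apply: (@le_lt_trans _ _
      (k%:E * \esum_(x in [set: 'rV[int]_n]) (f x)%:E)%E).
    apply: ge_ereal_sup => _ [A [finA _] <-].
    rewrite (eq_fsbigr (fun x => (k%:E * (f x)%:E)%E)); last first.
      by move=> x _; rewrite EFinM.
    rewrite -ge0_mule_fsumr; last by move=> x; rewrite lee_fin.
    rewrite lee_wpmul2l ?lee_fin//.
    by apply: ereal_sup_ubound; exists A.
  exact: lte_mul_pinfty.
apply: (@le_lt_trans _ _ (\esum_(x in [set: 'rV[int]_n])
    ((c * normc (u x) ^+ 2)%:E + (2 * normc (w x) ^+ 2)%:E)%E)).
  apply: le_esum => x _; rewrite -EFinD lee_fin.
  apply: (@le_trans _ _ ((normc a * normc (u x) + normc (w x)) ^+ 2)).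
    have nm : 0 <= normc a * normc (u x) by exact: mulr_ge0 (n0 _) (n0 _).
    rewrite lerXn2r ?nnegrE ?(addr_ge0 nm) ?n0//.
    by rewrite -normcM; exact: le_normcD.
  rewrite /c -subr_ge0.
  rewrite (_ : _ - _ = (normc a * normc (u x) - normc (w x)) ^+ 2).
    exact: sqr_ge0.
  by rewrite sqrrB sqrrD; ring.
have sq0 (k : R) z : 0 <= k -> 0 <= k * normc z ^+ 2.
  by move=> k0; rewrite mulr_ge0 ?sqr_ge0.
rewrite esumD => [|x _|x _]; rewrite ?lee_fin ?sq0//.
by apply: lte_add_pinfty; apply: scale => // x; rewrite sqr_ge0.
Qed.

HB.instance Definition _ := GRing.isSubmodClosed.Build R[i]
  ('rV[int]_n -> R[i]) (@square_summable R n) square_summable_submod.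

Record ell2 := Ell2 {
  ell2_fun :> 'rV[int]_n -> R[i];
  _ : ell2_fun \in @square_summable R n }.
HB.instance Definition _ := [isSub for ell2_fun].
HB.instance Definition _ := [Choice of ell2 by <:].
HB.instance Definition _ := [SubChoice_isSubLmodule of ell2 by <:].
End ell2_submodule.

Definition opnorm (R : realType) (n : nat) (T : ell2 R n -> ell2 R n) : \bar R :=
  ereal_sup [set l2norm (T g) | g in [set g : ell2 R n | (l2norm g <= 1)%E]].

Definition bounded_operators (R : realType) (n : nat) :
    set (ell2 R n -> ell2 R n) :=
  [set T | linear T /\ (opnorm T < +oo)%E].

Definition cocycle (R : realType) (n : nat) (theta : 'M[R[i]]_n)
    (l m : 'rV[int]_n) : R[i] :=
  \prod_(k < n) \prod_(j < n | (j < k)%N) theta k j ^ (l 0 k * m 0 j).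

Definition twisted_conv (R : realType) (n : nat) (theta : 'M[R[i]]_n)
    (f g : 'rV[int]_n -> R[i]) (x : 'rV[int]_n) : R[i] :=
  csum (fun y => f y * g (x - y) * cocycle theta y (x - y)).

(* For f in ell1, the twisted convolution of f with a square-summable function
   is square-summable (Young), so that the default value 0 is never used. *)
Definition regular_rep (R : realType) (n : nat) (theta : 'M[R[i]]_n)
    (f : 'rV[int]_n -> R[i]) (g : ell2 R n) : ell2 R n :=
  insubd (0 : ell2 R n) (twisted_conv theta f g).

(* The noncommutative torus C*(theta), realised on the Hilbert space by its
   faithful regular representation: the operator-norm closure of the image of
   ell1. *)
Definition nc_torus (R : realType) (n : nat) (theta : 'M[R[i]]_n) :
    set (ell2 R n -> ell2 R n) :=
  [set T | bounded_operators T /\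
    forall e : R, 0 < e ->
      exists2 f, ell1 f & (opnorm (T \- regular_rep theta f)%R < e%:E)%E].

(* A positive, submultiplicative, symmetric v satisfies v x ^+ 2 >= v 0 >= 1,
   so that weighted_ell1 v is contained in ell1. *)
Definition weighted_torus (R : realType) (n : nat) (theta : 'M[R[i]]_n)
    (v : 'rV[int]_n -> R) : set (ell2 R n -> ell2 R n) :=
  [set regular_rep theta f | f in weighted_ell1 v].

(* A and B are meant to be algebras of maps under composition, with common
   identity id. *)
Definition inverse_closed (X : Type) (A B : set (X -> X)) : Prop :=
  forall a b : X -> X, A a -> B b -> a \o b = id -> b \o a = id -> A b.

Definition GRS_condition (R : realType) (n : nat) (v : 'rV[int]_n -> R) : Prop :=
  forall x : 'rV[int]_n, (fun k : nat => v (x *+ k) `^ k%:R^-1) @ \oo --> (1 : R).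

(* Main.v *)
From HB Require Import structures.
Require Import Defs.
From mathcomp Require Import all_boot all_order all_algebra complex finmap.
From mathcomp Require Import all_classical all_reals all_analysis.
From mathcomp Require Import ring lra.
Set Implicit Arguments.
Unset Strict Implicit.
Unset Printing Implicit Defensive.
Import Order.TTheory GRing.Theory Num.Theory.
Import numFieldNormedType.Exports Normc.
Local Open Scope classical_set_scope.
Local Open Scope ring_scope.

(** That the GRS-condition implies inverse-closedness is a Wiener lemma, proved
    by a spectral argument in a Banach algebra with a large center.

    Let f in l1_v and suppose that its operator L is invertible on l2(Z^n).
    Consider the algebra of bounded operators on the vector-valued space
    l1_v(Z^n; l2) that commute with the translations of Z^n. It contains the
    symbol F = sum_y f(y) (lambda_y tr_y), where lambda_y acts on l2 and tr_y
    translates by y; the operators tr_y are central. If F has a right inverse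
    K, then applying K to delta_0 (x) delta_0 and keeping the diagonal
    coefficients gives h in l1_v with f * h = delta_0, and the operator of h is
    then the inverse of L ([weighted_inverse]).

    Suppose that F generates a proper right ideal. The GRS-condition says that
    the powers of each tr_y, positive or negative, grow subexponentially. For a
    central unit U of this kind and a proper right ideal J there is z on the
    unit circle such that J + (1 - z U) A is still proper ([circle_spectrum]):
    this is the nonemptiness of the spectrum of U modulo J, a spectrum that
    lies on the circle. Doing this for the n basis vectors ([joint_spectrum])
    produces a character c of Z^n and a proper right ideal that contains F and
    every 1 - c(y) tr_y. Modulo this ideal, F is arbitrarily close to sum_y
    f(y) c(y)^-1 lambda_y, the conjugate of L by the unitary operator of
    multiplication by c, and that operator is invertible: a contradiction
    ([symbol_right_inverse]).

    Conversely, 1 - r lambda_x with 0 < r < 1 is inverted by a Neumann series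
    whose coefficient at kx has modulus r^k. If the inverse has coefficients in
    l1_v, then r^k v(kx) is bounded for every r < 1 ([inverse_closed_bound]),
    and v >= 1, whence the GRS-condition. *)

(** * Families of nonnegative reals *)

(** For a nonnegative family, an upper bound on its sum that does not mention
    the sum: infinite sums are estimated below through their finite partial
    sums. *)
Definition sum_le (R : realType) (I : eqType) (f : I -> R) (c : R) : Prop :=
  forall s : seq I, uniq s -> \sum_(i <- s) f i <= c.

Section FiniteSums.
Variables (R : realType) (I : choiceType).
Implicit Types (f g : I -> R) (s : seq I).

Lemma sum_le_esum f c : (\esum_(i in [set: I]) (f i)%:E <= c%:E)%E ->
    sum_le f c.
Proof.
move=> fc s us; rewrite -lee_fin; apply: le_trans fc.
apply: ereal_sup_ubound; exists [set` s]; first by split; [exact: finite_seq|].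
by rewrite -fsbig_seq// sumEFin.
Qed.

Lemma esum_sum_le f c : sum_le f c ->
  (\esum_(i in [set: I]) (f i)%:E <= c%:E)%E.
Proof.
move=> fc; apply: ge_ereal_sup => _ [A [finA _] <-].
rewrite fsbig_finite//= sumEFin lee_fin; apply: fc; exact: fset_uniq.
Qed.

Lemma sum_le_fine f : (forall i, 0 <= f i) ->
  (\esum_(i in [set: I]) (f i)%:E < +oo)%E ->
  sum_le f (fine (\esum_(i in [set: I]) (f i)%:E)).
Proof.
move=> f0 foo; apply: sum_le_esum; rewrite fineK// ge0_fin_numE//.
by apply: esum_ge0 => i _; rewrite lee_fin.
Qed.

Lemma sum_le_ltoo f c : sum_le f c ->
  (\esum_(i in [set: I]) (f i)%:E < +oo)%E.
Proof. by move=> /esum_sum_le h; exact: le_lt_trans h (ltry _). Qed.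

Lemma sum_le_term f c i : sum_le f c -> f i <= c.
Proof. by move=> /(_ [:: i] isT); rewrite big_seq1. Qed.

Lemma sum_le_mono f g c : (forall i, f i <= g i) -> sum_le g c -> sum_le f c.
Proof. by move=> fg gc s us; apply: le_trans (gc s us); apply: ler_sum. Qed.

Lemma sum_leZ f (k c : R) : 0 <= k -> sum_le f c ->
  sum_le (fun i => k * f i) (k * c).
Proof.
by move=> k0 fc s us; rewrite -mulr_sumr ler_wpM2l// fc.
Qed.

Lemma sum_leD f g c d : sum_le f c -> sum_le g d ->
  sum_le (fun i => f i + g i) (c + d).
Proof. by move=> fc gd s us; rewrite big_split lerD ?fc ?gd. Qed.

Lemma sum_subset_le f s1 s2 : (forall i, 0 <= f i) -> uniq s1 -> uniq s2 ->
  {subset s1 <= s2} -> \sum_(i <- s1) f i <= \sum_(i <- s2) f i.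
Proof.
move=> f0 u1 u2 s12; rewrite [leRHS](bigID (mem s1))/= -[leLHS]addr0 lerD//.
  rewrite -[leRHS]big_filter (perm_big [seq i <- s2 | i \in s1])//.
  apply: uniq_perm => //; first exact: filter_uniq.
  by move=> i; rewrite mem_filter; case: (boolP (i \in s1)) => // /s12 ->.
exact: sumr_ge0.
Qed.

Definition tail_le f s (e : R) : Prop :=
  forall s', uniq s' -> (forall i, i \in s' -> i \notin s) ->
    \sum_(i <- s') f i <= e.

Lemma tail_exists f c : sum_le f c -> forall e : R, 0 < e ->
  exists s, uniq s /\ tail_le f s e.
Proof.
move=> fc e e0.
pose P := [set x : R | exists2 s, uniq s & x = \sum_(i <- s) f i].
have P0 : P 0 by exists [::]; rewrite ?big_nil.
have supP : has_sup P.
  split; first by exists 0.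
  by exists c => _ [s us ->]; exact: fc.
have [_ [s us ->] slt] := sup_adherent e0 supP.
exists s; split=> // s' us' dis.
have : \sum_(i <- s ++ s') f i <= sup P.
  apply: sup_upper_bound => //; exists (s ++ s') => //.
  rewrite cat_uniq us us' andbT/=; apply/hasPn => i /dis; exact.
rewrite big_cat/=; lra.
Qed.

Lemma tail_le_sub f s1 s2 e : {subset s1 <= s2} -> tail_le f s1 e ->
  tail_le f s2 e.
Proof.
move=> s12 h s' us' dis; apply: h => // i /dis; exact/contra/s12.
Qed.

End FiniteSums.

Lemma sum_le_reindex (R : realType) (I : eqType) (h h' : I -> I) (f : I ->
    R) c :
  cancel h h' -> sum_le f c -> sum_le (fun i => f (h i)) c.
Proof.
move=> hK fc s us; rewrite -(big_map h xpredT f); apply: fc.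
by rewrite map_inj_uniq//; exact: can_inj hK.
Qed.

(** * Normed spaces complete for rapidly Cauchy sequences *)

(** A complete norm, with real values, on a complex vector space. Completeness
    is required only for sequences whose successive differences are bounded by
    the powers of 1/2: this is enough to sum series, and it is inherited
    without topology by weighted sequence spaces and by operator algebras. *)
Record banach_norm (R : realType) (V : lmodType R[i]) := BanachNorm {
  bnorm :> V -> R;
  bnormD : forall x y, bnorm (x + y) <= bnorm x + bnorm y;
  bnormZ_le : forall a x, bnorm (a *: x) <= normc a * bnorm x;
  bnorm_le0 : forall x, bnorm x <= 0 -> x = 0;
  bnorm_complete : forall u : nat -> V,
    (forall k, bnorm (u k.+1 - u k) <= 2^-1 ^+ k) ->
    exists s, forall k, bnorm (s - u k) <= 2 * 2^-1 ^+ k }.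

Lemma normc_ge0 (R : realType) (z : R[i]) : 0 <= normc z.
Proof. by case: z => ? ?; exact: sqrtr_ge0. Qed.
#[global] Hint Extern 0 (is_true (@Order.le _ _ _ (normc _))) =>
  exact: normc_ge0 : core.

Lemma normcX (R : realType) (z : R[i]) k : normc (z ^+ k) = normc z ^+ k.
Proof.
by elim: k => [|k IH]; rewrite ?expr0 ?normc1// !exprS normcM IH.
Qed.

Lemma pow_small (R : realType) (q e : R) : 0 <= q < 1 -> 0 < e ->
  exists k0, forall k, (k0 <= k)%N -> q ^+ k <= e.
Proof.
move=> /andP[q0 q1] e0; have h : (fun k => q ^+ k : R) @ \oo --> (0 : R).
  by apply: cvg_expr; rewrite ger0_norm.
have [k0 _ hk] := (cvgrPdist_le _ _).1 h e e0.
exists k0 => k kk; have := hk k kk; rewrite sub0r normrN ger0_norm//.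
exact: exprn_ge0.
Qed.

Lemma half_pow_lt (R : realType) (e : R) : 0 < e ->
  exists k0, forall k, (k0 <= k)%N -> 2^-1 ^+ k <= e.
Proof.
move=> e0; apply: pow_small => //.
by rewrite invr_ge0 ler0n invf_lt1// ltr1n.
Qed.

Lemma le_half_pow (R : realType) (x y d : R) :
  (forall k0, exists2 k, (k0 <= k)%N & x <= y + d * 2^-1 ^+ k) -> x <= y.
Proof.
move=> h; apply/ler_addgt0Pr => e e0.
pose d' := `|d| + 1.
have d'0 : 0 < d' by rewrite /d' ltr_wpDl.
have [k0 hk] := half_pow_lt (divr_gt0 e0 d'0).
have [k /hk kle hx] := h k0.
apply: le_trans hx _; rewrite lerD2l.
rewrite ler_pdivlMr// in kle; apply: le_trans kle.
rewrite mulrC ler_wpM2l ?exprn_ge0 ?invr_ge0//.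
by rewrite /d' (le_trans (ler_norm d))// lerDl.
Qed.

Section BanachTheory.
Variables (R : realType) (V : lmodType R[i]) (N : banach_norm V).
Implicit Types (x y : V).

Lemma bnorm0 : N 0 = 0.
Proof.
have h : N 0 <= 0 by have := bnormZ_le N 0 0; rewrite scaler0 normc0 mul0r.
apply/eqP; rewrite eq_le h/=.
by have := bnormD N 0 0; rewrite addr0; lra.
Qed.

Lemma bnormN x : N (- x) = N x.
Proof.
have h y : N (- y) <= N y.
  by have := bnormZ_le N (- 1) y; rewrite scaleN1r normcN normc1 mul1r.
by apply/eqP; rewrite eq_le h/= -{1}[x]opprK h.
Qed.

Lemma bnorm_ge0 x : 0 <= N x.
Proof. by have := bnormD N x (- x); rewrite subrr bnorm0 bnormN; lra. Qed.

Lemma bnormB x y : N (x - y) <= N x + N y.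
Proof. by have := bnormD N x (- y); rewrite bnormN. Qed.

Lemma bnorm_distC x y : N (x - y) = N (y - x).
Proof. by rewrite -opprB bnormN. Qed.

Lemma bnorm_trans x y z : N (x - z) <= N (x - y) + N (y - z).
Proof. by have := bnormD N (x - y) (y - z); rewrite addrA subrK. Qed.

Lemma bnorm_sum (I : Type) (s : seq I) (u : I -> V) :
  N (\sum_(i <- s) u i) <= \sum_(i <- s) N (u i).
Proof.
elim/big_rec2: _ => [|i c x _ h]; first by rewrite bnorm0.
by apply: le_trans (bnormD _ _ _) _; rewrite lerD2l.
Qed.

Lemma bnormZ a x : N (a *: x) = normc a * N x.
Proof.
have [->|a0] := eqVneq a 0; first by rewrite scale0r bnorm0 normc0 mul0r.
apply/eqP; rewrite eq_le bnormZ_le/=.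
have na0 : 0 < normc a.
  by rewrite lt_neqAle normc_ge0 andbT eq_sym;
      apply: contra a0 => /eqP/eq0_normc ->.
have := bnormZ_le N a^-1 (a *: x); rewrite scalerA mulVf// scale1r normcV.
by rewrite ler_pdivlMl.
Qed.

Lemma bnorm_eq x y : (forall e : R, 0 < e -> N (x - y) <= e) -> x = y.
Proof.
move=> h; apply/eqP; rewrite -subr_eq0; apply/eqP/(bnorm_le0 (b := N)).
by apply/ler_addgt0Pr => e e0; rewrite add0r h.
Qed.

Lemma bnorm_completeZ (c : R) (u : nat -> V) : 0 <= c ->
  (forall k, N (u k.+1 - u k) <= c * 2^-1 ^+ k) ->
  exists s, forall k, N (s - u k) <= 2 * c * 2^-1 ^+ k.
Proof.
rewrite le_eqVlt => /predU1P[<- h|c0 h].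
  exists (u 0%N) => k; rewrite mulr0 mul0r.
  have -> : u k = u 0%N; last by rewrite subrr bnorm0.
  elim: k => // k <-; apply/eqP; rewrite -subr_eq0;
      apply/eqP/(bnorm_le0 (b := N)).
  by rewrite (le_trans (h k))// mul0r.
have nc : normc (c%:C)%C = c
    by rewrite /normc/= expr0n addr0 sqrtr_sqr gtr0_norm.
have c0' : (c%:C)%C != 0 by apply: contraTneq c0 => c0;
    rewrite -nc c0 normc0 ltxx.
have [k|s hs] := @bnorm_complete R V N (fun k => (c%:C)%C^-1 *: u k).
  rewrite -scalerBr bnormZ normcV nc mulrC ler_pdivrMr// mulrC; exact: h.
exists ((c%:C)%C *: s) => k.
rewrite -[u k]scale1r -(mulfV c0') -scalerA -scalerBr bnormZ nc.
by rewrite (mulrC 2) -mulrA ler_wpM2l ?(ltW c0).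
Qed.

(** Convergence of the net of finite partial sums, which does not depend on an
    enumeration of the index set. *)
Definition has_sum (I : eqType) (u : I -> V) (x : V) : Prop :=
  forall e : R, 0 < e -> exists s, uniq s /\
    forall s', uniq s' -> {subset s <= s'} -> N (x - \sum_(i <- s') u i) <= e.

Lemma has_sum_unique (I : eqType) (u : I -> V) x y :
  has_sum u x -> has_sum u y -> x = y.
Proof.
move=> hx hy; apply: bnorm_eq => e e0.
have [|s [us hs]] := hx (e / 2); first lra.
have [|t [ut ht]] := hy (e / 2); first lra.
pose w := undup (s ++ t).
have {}hs : N (x - \sum_(i <- w) u i) <= e / 2.
  by apply: hs (undup_uniq _) _ => i; rewrite mem_undup mem_cat => ->.
have {}ht : N (y - \sum_(i <- w) u i) <= e / 2.
  by apply: ht (undup_uniq _) _ => i; rewrite mem_undup mem_cat orbC => ->.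
have := bnorm_trans x (\sum_(i <- w) u i) y;
    rewrite (bnorm_distC (\sum_(i <- w) u i) y).
move: hs ht; lra.
Qed.

Lemma has_sum_ext (I : eqType) (u u' : I -> V) x :
  u =1 u' -> has_sum u x -> has_sum u' x.
Proof. by move=> uu; have -> : u' = u by apply/esym/funext. Qed.

Lemma has_sumD (I : eqType) (u u' : I -> V) x y :
  has_sum u x -> has_sum u' y -> has_sum (fun i => u i + u' i) (x + y).
Proof.
move=> hx hy e e0.
have [|s [us hs]] := hx (e / 2); first lra.
have [|t [ut ht]] := hy (e / 2); first lra.
exists (undup (s ++ t)); split=> [|w uw sw]; first exact: undup_uniq.
rewrite big_split/= opprD addrACA.
apply: le_trans (bnormD _ _ _) _; rewrite [e]splitr lerD//.
  by apply: hs => // i si; apply: sw; rewrite mem_undup mem_cat si.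
by apply: ht => // i si; apply: sw; rewrite mem_undup mem_cat si orbT.
Qed.

Lemma has_sum_seq (I : eqType) (u : I -> V) (s : seq I) : uniq s ->
  (forall i, i \notin s -> u i = 0) -> has_sum u (\sum_(i <- s) u i).
Proof.
move=> us u0 e e0; exists s; split=> // s' us' ss'.
rewrite [X in _ - X](bigID (mem s))/= [X in _ - (_ + X)]big1; last first.
  by move=> i; exact: u0.
rewrite addr0 -[X in _ - X]big_filter.
rewrite [X in _ - X](_ : _ = \sum_(i <- s) u i);
    first by rewrite subrr bnorm0 ltW.
apply/perm_big/uniq_perm => //; first exact: filter_uniq.
by move=> i; rewrite mem_filter; case: (boolP (i \in s)) => // /ss' ->.
Qed.

(** Partial sums over finite sets with tails at most 2^-k/2 form a rapidly
    Cauchy sequence. *)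
Lemma has_sum_exists (I : choiceType) (u : I -> V) c :
  sum_le (fun i => N (u i)) c -> exists x, has_sum u x.
Proof.
move=> uc.
have N0 i : 0 <= N (u i) by exact: bnorm_ge0.
have /choice[s hs] : forall k : nat, exists s,
    uniq s /\ tail_le (fun i => N (u i)) s (2^-1 * 2^-1 ^+ k).
  move=> k; apply: tail_exists uc _ _.
  by rewrite mulr_gt0 ?exprn_gt0 ?invr_gt0.
have dif (s1 s2 : seq I) e1 e2 : uniq s1 -> uniq s2 ->
    tail_le (fun i => N (u i)) s1 e1 -> tail_le (fun i => N (u i)) s2 e2 ->
    N (\sum_(i <- s2) u i - \sum_(i <- s1) u i) <= e1 + e2.
  move=> u1 u2 h1 h2.
  rewrite [X in N (X - _)](bigID (mem s1))/= [X in N (_ - X)](bigID (mem s2))/=.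
  have -> : \sum_(i <- s2 | i \in s1) u i = \sum_(i <- s1 | i \in s2) u i.
    rewrite -!(big_filter _ (fun i => i \in _)); apply: perm_big.
    apply: uniq_perm; rewrite ?filter_uniq// => i.
    by rewrite !mem_filter andbC.
  rewrite opprD addrACA subrr add0r.
  apply: le_trans (bnormB _ _) _.
  rewrite -[X in N X + _]big_filter -[X in _ + N X]big_filter.
  apply: lerD; apply: le_trans (bnorm_sum _ _) _.
    apply: h1; first exact: filter_uniq.
    by move=> i; rewrite mem_filter => /andP[].
  apply: h2; first exact: filter_uniq.
  by move=> i; rewrite mem_filter => /andP[].
have [k|x hx] := @bnorm_complete R V N (fun k => \sum_(i <- s k) u i).
  have [u1 h1] := hs k; have [u2 h2] := hs k.+1.
  apply: le_trans (dif _ _ _ _ u1 u2 h1 h2) _.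
  rewrite exprS; have : 0 <= 2^-1 ^+ k :> R by rewrite exprn_ge0 ?invr_ge0.
  lra.
exists x => e e0.
have [|k0 hk] := @half_pow_lt R (e / 4); first lra.
have {}hk := hk k0 (leqnn _).
exists (s k0); split=> [|s' us' ss']; first by case: (hs k0).
have [u1 h1] := hs k0.
have d := dif _ _ _ _ us' u1 (tail_le_sub ss' h1) h1.
have := bnorm_trans x (\sum_(i <- s k0) u i) (\sum_(i <- s') u i).
have := hx k0; lra.
Qed.

End BanachTheory.

Lemma has_sum_map (R : realType) (V W : lmodType R[i]) (N : banach_norm V)
    (M : banach_norm W) (phi : V -> W) (c : R) (I : eqType) (u : I -> V) x :
  linear phi -> (forall y, M (phi y) <= c * N y) ->
  has_sum N u x -> has_sum M (fun i => phi (u i)) (phi x).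
Proof.
move=> lphi bphi hx e e0.
pose phil := GRing.isLinear.Build _ _ _ _ phi lphi.
pose phiL : {linear V -> W} := HB.pack phi phil.
have e1 : 0 < e / (`|c| + 1) by rewrite divr_gt0// ltr_wpDl.
have [s [us hs]] := hx _ e1; exists s; split=> // s' us' ss'.
have -> : \sum_(i <- s') phi (u i) = phi (\sum_(i <- s') u i).
  by rewrite -[phi]/(phiL : V -> W) linear_sum.
have -> : phi x - phi (\sum_(i <- s') u i) = phi (x - \sum_(i <- s') u i).
  by rewrite -[phi]/(phiL : V -> W) linearB.
apply: le_trans (bphi _) _; have := hs s' us' ss'.
rewrite ler_pdivlMr ?ltr_wpDl// => h; apply: le_trans h.
rewrite mulrC ler_wpM2l ?bnorm_ge0//.
by rewrite (le_trans (ler_norm c))// lerDl.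
Qed.

(** * Central units and proper right ideals *)

Section Circle.
Variable R : realType.

Lemma normc_Complex (a b : R) : normc (Complex a b) <= `|a| + `|b|.
Proof.
rewrite /normc/= -(@ler_pXn2r _ 2)// ?nnegrE ?sqrtr_ge0 ?addr_ge0//.
rewrite sqr_sqrtr ?addr_ge0 ?sqr_ge0// sqrrD !real_normK ?num_real//.
by rewrite lerD2r lerDl mulrn_wge0// mulr_ge0.
Qed.

Lemma normc_real (a : R) : normc (a%:C)%C = `|a|.
Proof. by rewrite /normc/= expr0n addr0 sqrtr_sqr. Qed.

(** Compactness of the unit circle, each half of which is a graph over the
    interval from -1 to 1. *)
Lemma circle_uniform (Q : R[i] -> R -> Prop) :
  (forall z K K', K <= K' -> Q z K -> Q z K') ->
  (forall z, normc z = 1 -> exists K d : R, 0 < d /\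
     forall z', normc z' = 1 -> normc (z' - z) < d -> Q z' K) ->
  exists K, forall z, normc z = 1 -> Q z K.
Proof.
move=> Qmono Qloc.
pose zz (s x : R) : R[i] := Complex x (s * Num.sqrt (1 - x ^+ 2)).
have zz1 (s x : R) : s ^+ 2 = 1 -> x \in `[-1, 1] -> normc (zz s x) = 1.
  move=> s1; rewrite in_itv/= => /andP[x1 x2].
  rewrite /normc/= exprMn s1 mul1r sqr_sqrtr;
      first by rewrite addrC subrK sqrtr1.
  by rewrite subr_ge0 -[leRHS](expr1n _ 2) -(@real_normK _ x) ?num_real//
      lerXn2r ?nnegrE// ler_norml x1.
have half (s : R) : s ^+ 2 = 1 -> exists K, forall x, x \in `[-1, 1] ->
    Q (zz s x) K.
  move=> s1; have /compact_near_coveringP := @segment_compact R (-1) 1.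
  move=> /(_ R +oo (fun K x => x \in `[-1, 1] -> Q (zz s x) K) _) [].
    move=> x xI; have [K [d [d0 hd]]] := Qloc _ (zz1 s x s1 xI).
    have d2 : 0 < d / 2 by lra.
    have cx : (fun x' : R =>
        Num.sqrt (1 - x' ^+ 2)) x' @[x' --> x] --> Num.sqrt (1 - x ^+ 2).
      apply: continuous_cvg; first exact: sqrt_continuous.
      by apply: cvgB; [exact: cvg_cst|exact: exprn_continuous].
    have n1 : \forall x' \near x, `|x - x'| < d / 2 by exact: nbhsx_ballx.
    have n2 : \forall x' \near x,
        `|Num.sqrt (1 - x ^+ 2) - Num.sqrt (1 - x' ^+ 2)| < d / 2.
      exact: (cvgr_dist_lt _ _ cx).
    have n3 : \forall K' \near +oo, K <= K' by apply: nbhs_pinfty_ge;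
        exact: num_real.
    exists ([set x' | `|x - x'| < d / 2 /\
        `|Num.sqrt (1 - x ^+ 2) - Num.sqrt (1 - x' ^+ 2)| < d / 2],
            [set K' | K <= K']).
      by split=> //; near=> x'; split; near: x'.
    move=> [x' K'] /= [[hx hs] KK'] x'I; apply: (@Qmono _ K) => //.
    apply: hd; first exact: zz1.
    have -> : zz s x' - zz s x
        = Complex (x' - x) (s * (Num.sqrt (1 - x' ^+ 2) - Num.sqrt (1 - x ^+
        2))).
      by rewrite mulrBr.
    apply: le_lt_trans (normc_Complex _ _) _.
    have ns : `|s| = 1 by apply/eqP;
        rewrite -(@eqrXn2 _ 2)// expr1n real_normK ?num_real// s1.
    by rewrite normrM ns mul1r [d]splitr; apply: ltrD; rewrite distrC.
  move=> K0 [_ hK]; exists (K0 + 1) => x xI; apply: hK => //.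
  by rewrite ltrDl.
have [K1 h1] := half 1 (expr1n _ 2).
have [|K2 h2] := half (-1); first by rewrite sqrrN expr1n.
exists (Num.max K1 K2) => -[x y] n1.
have xy : x ^+ 2 + y ^+ 2 = 1.
  move: n1; rewrite /normc/= => n1.
  by rewrite -[LHS]sqr_sqrtr ?addr_ge0 ?sqr_ge0// n1 expr1n.
have xI : x \in `[-1, 1].
  rewrite in_itv/= -ler_norml -(@ler_pXn2r _ 2)// ?nnegrE// real_normK
      ?num_real// expr1n -xy lerDl.
  exact: sqr_ge0.
have e : Num.sqrt (1 - x ^+ 2) = `|y| by rewrite -xy addrC addKr sqrtr_sqr.
have [y0|y0] := leP 0 y.
  have -> : Complex x y = zz 1 x by rewrite /zz mul1r e ger0_norm.
  by apply: Qmono (h1 x xI); rewrite le_max lexx.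
have -> : Complex x y = zz (-1) x by rewrite /zz mulN1r e ltr0_norm// opprK.
by apply: Qmono (h2 x xI); rewrite le_max lexx orbT.
Unshelve. all: by end_near. Qed.

(** The root comes from algebraic closedness; its choice does not matter, since
    the multiplicativity of the modulus puts every root on the unit circle. *)
Lemma dyadic_root_m1 k : exists eta : R[i], normc eta = 1 /\
    eta ^+ (2 ^ k) = -1.
Proof.
have k0 : (0 < 2 ^ k)%N by rewrite expn_gt0.
exists ((2 ^ k).-root (-1)); rewrite rootCK//; split=> //.
have h : normc ((2 ^ k).-root (-1 : R[i])) ^+ (2 ^ k) = 1.
  by rewrite -normcX rootCK// normcN normc1.
by apply/eqP; rewrite -(@pexpr_eq1 _ _ (2 ^ k)) ?h.
Qed.

End Circle.

Section ProperRightIdeals.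
Variables (R : realType) (A : pzRingType) (N : A -> R).
Variable iota : {rmorphism R[i] -> A}.
Hypothesis ND : forall x y, N (x + y) <= N x + N y.
Hypothesis NN : forall x, N (- x) = N x.
Hypothesis N_ge0 : forall x : A, 0 <= N x.
Hypothesis NM : forall x y, N (x * y) <= N x * N y.
Hypothesis N1 : N 1 <= 1.
Hypothesis Niota : forall z x, N (iota z * x) <= normc z * N x.
Hypothesis iotaC : forall z x, iota z * x = x * iota z.
Hypothesis inv_near1 : forall c, N (1 - c) <= 2^-1 -> exists d : A, c * d = 1.

Implicit Types (J : A -> Prop) (x y p b : A) (z : R[i]) (K e : R).

Definition central x : Prop := forall y, x * y = y * x.

Definition right_ideal J : Prop :=
  [/\ J 0, forall x y, J x -> J y -> J (x + y) & forall x y, J x -> J (x * y)].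

(** An upper bound on the distance to [J], that is, on the norm in the quotient
    by the closure of [J]. *)
Definition near_ideal J x e : Prop := exists2 j, J j & N (x - j) <= e.

Definition subexponential (U : A) : Prop :=
  forall rho e : R, 0 < rho < 1 -> 0 < e ->
    exists k0, forall k, (k0 <= k)%N -> rho ^+ k * N (U ^+ k) <= e.

Lemma idealN J x : right_ideal J -> J x -> J (- x).
Proof. by move=> [_ _ JM] Jx; rewrite -mulrN1; exact: JM. Qed.

Lemma central_ideal J x y : right_ideal J -> central x -> J y -> J (x * y).
Proof. by move=> [_ _ JM] xc Jy; rewrite xc; exact: JM. Qed.

Lemma ideal_sum J (I : Type) (s : seq I) (u : I -> A) : right_ideal J ->
  (forall i, J (u i)) -> J (\sum_(i <- s) u i).
Proof. by move=> [J0 JD _] Ju; elim/big_ind: _. Qed.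

Lemma near_idealD J x y d e : right_ideal J ->
  near_ideal J x d -> near_ideal J y e -> near_ideal J (x + y) (d + e).
Proof.
move=> [_ JD _] [j Jj hj] [k Jk hk]; exists (j + k); first exact: JD.
by rewrite opprD addrACA; apply: le_trans (ND _ _) _; rewrite lerD.
Qed.

Lemma near_idealM J x y e : right_ideal J ->
  near_ideal J x e -> near_ideal J (x * y) (e * N y).
Proof.
move=> [_ _ JM] [j Jj hj]; exists (j * y); first exact: JM.
by rewrite -mulrBl; apply: le_trans (NM _ _) _; rewrite ler_wpM2r.
Qed.

(** A proper right ideal stays at a definite distance from 1, even if it is not
    closed: an element near 1 has a right inverse. *)
Lemma proper_far1 J e : right_ideal J -> ~ J 1 -> e <= 2^-1 ->
    ~ near_ideal J 1 e.
Proof.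
move=> [_ _ JM] J1 e2 [j Jj /le_trans/(_ e2)/inv_near1[d jd]].
by apply: J1; rewrite -jd; exact: JM.
Qed.

Lemma inv_bound (c d : A) : N (1 - c) <= 2^-1 -> c * d = 1 -> N d <= 2.
Proof.
move=> c1 cd;
    have e : d = 1 + (1 - c) * d by rewrite mulrBl cd mul1r addrC subrK.
have h1 : N d <= N 1 + N ((1 - c) * d) by rewrite {1}e.
have h2 := NM (1 - c) d.
have h3 : N (1 - c) * N d <= 2^-1 * N d by rewrite ler_wpM2r.
move: N1 h1 h2 h3; lra.
Qed.

Lemma central_inv x y : central x -> x * y = 1 -> central y.
Proof.
move=> xc xy w.
by rewrite -[w in LHS]mulr1 -[X in _ * (_ * X)]xy (mulrA w) -xc !mulrA -xc xy
    mul1r.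
Qed.

Lemma centralX x k : central x -> central (x ^+ k).
Proof. by move=> xc y; apply/commr_sym/commrX/commr_sym/xc. Qed.

Lemma central_iotaM z x : central x -> central (iota z * x).
Proof. by move=> xc y; rewrite -mulrA xc mulrA iotaC -mulrA iotaC mulrA. Qed.

Lemma centralM x y : central x -> central y -> central (x * y).
Proof. by move=> xc yc w; rewrite -mulrA yc mulrA xc mulrA. Qed.

Lemma centralD x y : central x -> central y -> central (x + y).
Proof. by move=> xc yc w; rewrite mulrDl xc yc mulrDr. Qed.

Lemma centralN x : central x -> central (- x).
Proof. by move=> xc w; rewrite mulNr xc mulrN. Qed.

Lemma central1 : central 1.
Proof. by move=> w; rewrite mulr1 mul1r. Qed.

Lemma exp_iotaM z U k : (iota z * U) ^+ k = iota (z ^+ k) * U ^+ k.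
Proof. by rewrite exprMn_comm ?rmorphXn//; exact: iotaC. Qed.

Section OneUnit.
Variables (J : A -> Prop) (U V : A).
Hypotheses (Ji : right_ideal J) (Uc : central U) (UV : U * V = 1).
Hypotheses (Ug : subexponential U) (Vg : subexponential V).

(** A quantitative form of the failure of [J + (1 - z U) A] to be proper: the
    bound on the coefficient [b] is what controls resolvents near [z]. *)
Definition unit_witness z K : Prop :=
  exists j b, [/\ J j, 1 = j + (1 - iota z * U) * b & N b <= K].

(** Perturbing [z] multiplies the coefficient by the right inverse of an
    element near 1. *)
Lemma unit_witness_near z0 z K : unit_witness z0 K ->
  normc (z - z0) * (N U * K) <= 2^-1 -> unit_witness z (2 * K).
Proof.
move=> [j [b [Jj e1 bK]]] hz.
pose c := 1 - iota (z - z0) * (U * b).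
have c1 : N (1 - c) <= 2^-1.
  rewrite /c opprB addrC subrK; apply: le_trans (Niota _ _) _;
      apply: le_trans hz.
  by rewrite ler_wpM2l//; apply: le_trans (NM _ _) _; rewrite ler_wpM2l.
have [d cd] := inv_near1 c1; have d2 := inv_bound c1 cd.
exists (j * d), (b * d); split; first by case: Ji => _ _; exact.
  have -> : (1 - iota z * U) * (b * d) = (c - j) * d.
    have e2 : (1 - iota z0 * U) * b = 1 - j
        by rewrite [X in X - j]e1 [in RHS]addrC addKr.
    have e3 : 1 - iota z * U = 1 - iota z0 * U - iota (z - z0) * U.
      by rewrite rmorphB mulrBl opprB addrA subrK.
    by rewrite mulrA e3 [in LHS]mulrBl e2 addrAC -mulrA.
  by rewrite mulrBl addrC subrK.
apply: le_trans (NM _ _) _; rewrite mulrC ler_pM//.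
Qed.

Lemma unit_witness_uniform :
  (forall z, normc z = 1 -> exists K, unit_witness z K) ->
  exists K, 0 < K /\ forall z, normc z = 1 -> unit_witness z K.
Proof.
move=> hw; have wmono z K K' : K <= K' -> unit_witness z K -> unit_witness z K'.
  by move=> KK [j [b [Jj e bK]]]; exists j, b; split=> //; exact: le_trans KK.
have [|K hK] := @circle_uniform R unit_witness wmono.
  move=> z z1; have [K wK] := hw z z1.
  have K0 : 0 <= K by case: wK => [j [b [_ _]]]; exact: le_trans.
  have NK0 : 0 < 2 * (N U * K) + 1 by rewrite ltr_wpDl// mulr_ge0// mulr_ge0.
  exists (2 * K), (2 * (N U * K) + 1)^-1; split; first by rewrite invr_gt0.
  move=> z' _ zd; apply: unit_witness_near wK _.
  have NUK : 0 <= N U * K by rewrite mulr_ge0.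
  apply: (@le_trans _ _ ((2 * (N U * K) + 1)^-1 * (N U * K))).
    by rewrite ler_wpM2r// ltW.
  by rewrite ler_pdivrMl//; lra.
exists (`|K| + 1); split=> [|z z1]; first by rewrite ltr_wpDl.
by apply: wmono (hK z z1); rewrite (le_trans (ler_norm K))// lerDl.
Qed.

(** The resolvent (1 - z U)^-1 is, modulo [J], the coefficient of a witness;
    this bounds it however close [z] is to the circle. *)
Lemma resolvent_split z0 z K p : unit_witness z0 K ->
  normc (z - z0) * (N U * K) <= 2^-1 -> central p -> (1 - iota z * U) * p = 1 ->
  exists j b, [/\ J j, p = j + b & N b <= 2 * K].
Proof.
move=> w hz pc zp; have [j [b [Jj e bK]]] := unit_witness_near w hz.
exists (p * j), b; split=> //; first exact: central_ideal.
by rewrite -{1}[p]mulr1 [X in p * X]e mulrDr mulrA [p * (1 - _)]pc zp mul1r.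
Qed.

Lemma resolvent_diff z0 z z' K p p' : unit_witness z0 K ->
  normc (z - z0) * (N U * K) <= 2^-1 -> normc (z' - z0) * (N U * K) <= 2^-1 ->
  central p -> central p' ->
  (1 - iota z * U) * p = 1 -> (1 - iota z' * U) * p' = 1 ->
  near_ideal J (p - p') (2 * K * (2 * K) * (normc (z - z') * N U)).
Proof.
move=> w hz hz' pc pc' zp zp'.
have [j1 [b1 [Jj1 e1 bK1]]] := resolvent_split w hz pc zp.
have [j2 [b2 [Jj2 e2 bK2]]] := resolvent_split w hz' pc' zp'.
have K0 : 0 <= 2 * K by apply: le_trans bK1.
have near2 : near_ideal J (p * p') (2 * K * (2 * K)).
  have [_ JD JM] := Ji; exists (j1 * p' + j2 * b1); first by apply: JD;
      exact: JM.
  have -> : p * p' - (j1 * p' + j2 * b1) = b2 * b1.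
    have -> : p * p' = j1 * p' + p' * b1
        by rewrite [in LHS]e1 mulrDl [p' * b1]pc'.
    by rewrite [in p' * b1]e2 mulrDl opprD addrACA subrr add0r addrC addKr.
  by apply: le_trans (NM _ _) _; rewrite ler_pM.
have ww : central (iota (z - z') * U) by exact: central_iotaM.
have -> : p - p' = p * p' * (iota (z - z') * U).
  rewrite -mulrA -ww mulrA rmorphB mulrBl.
  have -> : iota z * U - iota z' * U = (1 - iota z' * U) - (1 - iota z * U).
    by rewrite opprB [RHS]addrC addrA subrK.
  by rewrite mulrBr mulrBl -mulrA zp' mulr1 [p * (1 - _)]pc zp mul1r.
have [j Jj hj] := near_idealM (iota (z - z') * U) Ji near2.
exists j => //; apply: le_trans hj _.
by apply: ler_wpM2l; [exact: (mulr_ge0 K0 K0)|exact: Niota].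
Qed.

(** Averaging over square roots: 2 (1 - y^2)^-1 = (1 - y)^-1 + (1 + y)^-1, and
    passing from [y] to [-y] only rotates [z]. So a bound on the difference of
    resolvents of [U] on two circles is inherited by the resolvents of all
    (2^k)-th powers of [U], with the same constant. *)
Lemma resolvent_diff_dyadic (s s' : R[i]) e :
  (forall z p p', normc z = 1 -> central p -> central p' ->
     (1 - iota (s * z) * U) * p = 1 -> (1 - iota (s' * z) * U) * p' = 1 ->
     near_ideal J (p - p') e) ->
  forall k z p p', normc z = 1 -> central p -> central p' ->
     (1 - (iota (s * z) * U) ^+ (2 ^ k)) * p = 1 ->
     (1 - (iota (s' * z) * U) ^+ (2 ^ k)) * p' = 1 ->
     near_ideal J (p - p') e.
Proof.
move=> base; elim=> [|k IH] z p p' z1 pc pc'; first by rewrite !expr1;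
    exact: base.
(* [eta] rotates [z] so that the (2^k)-th power changes sign. *)
rewrite expnSr !exprM.
have [eta [eta1 etaN]] := dyadic_root_m1 R k.
have rot w : (iota (w * (z * eta)) * U) ^+ (2 ^ k)
    = - (iota (w * z) * U) ^+ (2 ^ k).
  by rewrite !exp_iotaM mulrA exprMn etaN mulrN1 rmorphN mulNr.
have := IH (z * eta) _ _ _ _ _; rewrite !rot normcM z1 eta1 mulr1 !opprK.
have := IH z _ _ z1.
set y := (iota (s * z) * U) ^+ (2 ^ k);
    set y' := (iota (s' * z) * U) ^+ (2 ^ k).
move=> IH1 IH2 hp hp'.
have yc : central y by apply/centralX/central_iotaM.
have yc' : central y' by apply/centralX/central_iotaM.
have sqr1 (w : A) : (1 - w) * (1 + w) = 1 - w ^+ 2.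
  by rewrite mulrDr mulr1 mulrBl mul1r expr2 addrA subrK.
have sqr2 (w : A) : (1 + w) * (1 - w) = 1 - w ^+ 2.
  by rewrite mulrBr mulr1 mulrDl mul1r expr2 opprD addrA addrK.
have cD (w q : A) : central w -> central q -> central ((1 + w) * q).
  by move=> wc; apply: centralM; exact: centralD central1 wc.
have cB (w q : A) : central w -> central q -> central ((1 - w) * q).
  by move=> /centralN; exact: cD.
have h1 : near_ideal J ((1 + y) * p - (1 + y') * p') e.
  by apply: IH1; rewrite ?mulrA ?sqr1//; exact: cD.
have h2 : near_ideal J ((1 - y) * p - (1 - y') * p') e.
  by apply: IH2; rewrite ?mulrA ?sqr2//; exact: cB.
have [j Jj hj] := near_idealM (iota 2^-1) Ji (near_idealD Ji h1 h2).
have e0 : 0 <= e by case: h1 => j1 _; exact: le_trans.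
have half2 : normc (2^-1 : R[i]) = 2^-1.
  rewrite normcV; congr (_^-1).
  by have := normc_real (2 : R); rewrite rmorph_nat ger0_norm.
have half1 : N (iota 2^-1) <= 2^-1.
  rewrite -[iota _]mulr1; apply: le_trans (Niota _ _) _; rewrite half2.
  by rewrite -[leRHS]mulr1 ler_wpM2l// invr_ge0.
have dbl (w q : A) : (1 + w) * q + (1 - w) * q = q *+ 2.
  by rewrite -mulrDl addrACA subrr addr0 mulrDl mul1r.
exists j => //; apply: le_trans (le_trans hj _).
  rewrite addrACA -opprD !dbl -mulrnBl mulrnAl -mulrnAr -rmorphMn -mulr_natl.
  by rewrite mulfV ?rmorph1 ?mulr1// pnatr_eq0.
have : (e + e) * N (iota 2^-1) <= (e + e) * 2^-1
    by rewrite ler_wpM2l// addr_ge0.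
lra.
Qed.

(** If 1 lay in [J + (1 - z U) A] for every [z] on the circle, the resolvents
    would be bounded near the circle modulo [J], so that those just inside and
    just outside of it would be close. Passing to high powers, the first
    becomes (1 - 0)^-1 = 1 and the second (1 - oo)^-1 = 0: then 1 would be
    close to [J]. *)
Lemma circle_spectrum : ~ J 1 ->
  exists2 z, normc z = 1 & ~ exists j b, J j /\ 1 = j + (1 - iota z * U) * b.
Proof.
move=> J1; apply: contrapT => noz.
have [z z1|K [K0 hK]] := unit_witness_uniform.
  apply: contrapT => nw; apply: noz; exists z => // -[j [b [Jj e]]].
  by apply: nw; exists (N b), j, b.
(* [d] is so small that resolvents at distance [d] from the circle are bounded
   modulo [J] by [resolvent_split], and that those at [1 - d] and [1 + d]
   differ by at most 1/16. *)
pose M := N U + 1; have M0 : 0 < M by rewrite ltr_wpDl.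
pose d : R := (2 * (M * K) + 128 * (K * K * M) + 2)^-1.
have D0 : 0 < 2 * (M * K) + 128 * (K * K * M) + 2.
  by rewrite !addr_gt0 ?mulr_gt0.
have d0 : 0 < d by rewrite invr_gt0.
have dD : d * (2 * (M * K) + 128 * (K * K * M) + 2) = 1
    by rewrite mulVf// gt_eqF.
have MK0 : 0 < d * (M * K) by rewrite !mulr_gt0.
have KM0 : 0 < d * (K * K * M) by rewrite !mulr_gt0.
have d1 : d < 1 by move: dD MK0 KM0; rewrite !mulrDr; lra.
have NUM : N U <= M by rewrite lerDl.
pose s := ((1 - d)%:C)%C; pose s' := ((1 + d)%:C)%C.
have base z p p' : normc z = 1 -> central p -> central p' ->
    (1 - iota (s * z) * U) * p = 1 -> (1 - iota (s' * z) * U) * p' = 1 ->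
    near_ideal J (p - p') (16^-1).
  move=> z1 pc pc' hp hp'.
  have close (t : R) : `|t| = d ->
      normc (((1 + t)%:C)%C * z - z) * (N U * K) <= 2^-1.
    move=> td; have -> : ((1 + t)%:C)%C * z - z = (t%:C)%C * z.
      by rewrite rmorphD rmorph1 mulrDl mul1r addrC addKr.
    rewrite normcM z1 mulr1 normc_real td.
    apply: (@le_trans _ _ (d * (M * K))).
      by rewrite ler_wpM2l ?(ltW d0)// ler_wpM2r// ltW.
    by move: dD MK0 KM0; rewrite !mulrDr; lra.
  have [||j Jj hj] := resolvent_diff (hK z z1) _ _ pc pc' hp hp'.
  - by apply: close; rewrite normrN gtr0_norm.
  - by apply: close; rewrite gtr0_norm.
  exists j => //; apply: le_trans hj _.
  have -> : normc (s * z - s' * z) = 2 * d.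
    rewrite -mulrBl normcM z1 mulr1 -rmorphB normc_real opprD addrACA subrr
        add0r.
    by rewrite -opprD normrN gtr0_norm ?addr_gt0//; lra.
  have : 2 * K * (2 * K) * (2 * d * N U) <= 2 * K * (2 * K) * (2 * d * M).
    by rewrite ler_wpM2l ?mulr_ge0 ?(ltW K0)// ler_wpM2l ?mulr_ge0 ?(ltW d0).
  have -> : 2 * K * (2 * K) * (2 * d * M) = 8 * (d * (K * K * M)) by ring.
  by move: dD MK0 KM0; rewrite !mulrDr; lra.
have dyadic := resolvent_diff_dyadic base.
have pow_gt k : (k <= 2 ^ k)%N by apply: ltnW; exact: ltn_expl.
(* For a high power [m] of 2, both [((1 - d) U) ^ m] and the inverse of [((1 +
   d) U) ^ m] have norm at most 1/16. *)
have d1' : 0 < (1 + d)^-1 < 1 by rewrite invr_gt0 invf_lt1 ?ltrDl ?addr_gt0.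
have [||k1 hU] := @Ug (1 - d) 16^-1; [lra|by []|].
have [||k2 hV] := @Vg (1 + d)^-1 16^-1; [by []|by []|].
pose m := (2 ^ (maxn k1 k2))%N.
have {}hU : N ((iota s * U) ^+ m) <= 16^-1.
  rewrite exp_iotaM; apply: le_trans (Niota _ _) _; rewrite normcX normc_real.
  rewrite gtr0_norm ?subr_gt0//; apply: hU.
  by rewrite (leq_trans _ (pow_gt _))// leq_maxl.
pose y' := (iota s'^-1 * V) ^+ m.
have {}hV : N y' <= 16^-1.
  rewrite /y' exp_iotaM; apply: le_trans (Niota _ _) _;
      rewrite normcX normcV normc_real.
  rewrite gtr0_norm ?addr_gt0//; apply: hV.
  by rewrite (leq_trans _ (pow_gt _))// leq_maxr.
have Vc : central V by exact: central_inv UV.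
have yy' : (iota s' * U) ^+ m * y' = 1.
  rewrite /y' -exprMn_comm; last by apply/esym/central_iotaM.
  rewrite -mulrA (mulrA U) Uc -mulrA UV mulr1 -rmorphM mulfV ?rmorph1 ?expr1n//.
  by apply: contraTneq d0 => /(congr1 (@normc R));
      rewrite normc_real normc0 => /normr0_eq0; lra.
have inv16 (w : A) : N w <= 16^-1 -> central w ->
    exists q, [/\ (1 - w) * q = 1, central q, N q <= 2 & N (1 - q) <= 8^-1].
  move=> w16 wc; have w2 : N (1 - (1 - w)) <= 2^-1.
    by rewrite opprB addrC subrK; apply: le_trans w16 _; lra.
  have [q hq] := inv_near1 w2; have q2 := inv_bound w2 hq.
  exists q; split=> //; first by apply: central_inv hq;
      apply/centralD/centralN/wc/central1.
  have -> : 1 - q = - (w * q)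
      by rewrite -[X in X - _]hq mulrBl mul1r addrAC subrr add0r.
  rewrite NN; apply: le_trans (NM _ _) _.
  have : N w * N q <= 16^-1 * 2 by rewrite ler_pM.
  lra.
have [|p [hp pc p2 p8]] := inv16 _ hU; first by apply/centralX/central_iotaM.
have [|q [hq qc q2 q8]] := inv16 _ hV; first by apply/centralX/central_iotaM.
(* For x = ((1 + d) U)^m, whose inverse is [y'], one has (1 - x)^-1 = - y' (1 -
   y')^-1. *)
have p'c : central (- (y' * q)).
  by apply/centralN/centralM => //; apply/centralX/central_iotaM.
have hp' : (1 - (iota s' * U) ^+ m) * - (y' * q) = 1.
  by rewrite mulrN mulrBl mul1r mulrA yy' mul1r opprB -[RHS]hq mulrBl mul1r.
have Ny'q : N (y' * q) <= 8^-1.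
  by apply: le_trans (NM _ _) _;
      have : N y' * N q <= 16^-1 * 2 by [rewrite ler_pM|]; lra.
have := dyadic (maxn k1 k2) 1 p (- (y' * q)) (@normc1 R) pc p'c.
rewrite !mulr1 opprK => /(_ hp hp')[j Jj hj].
apply: (@proper_far1 J 2^-1 Ji J1 (lexx _)); exists j => //.
have -> : 1 - j = (1 - p) - y' * q + (p + y' * q - j).
  by rewrite addrA addrACA addNr addr0 subrK.
have := ND (1 - p - y' * q) (p + y' * q - j).
have := ND (1 - p) (- (y' * q)); rewrite NN.
lra.
Qed.

End OneUnit.

Lemma ideal_extend J U z : right_ideal J ->
  right_ideal (fun x => exists j b, J j /\ x = j + (1 - iota z * U) * b).
Proof.
move=> [J0 JD JM]; split.
- by exists 0, 0; rewrite mulr0 addr0.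
- move=> _ _ [j1 [b1 [Jj1 ->]]] [j2 [b2 [Jj2 ->]]].
  by exists (j1 + j2), (b1 + b2); split; [exact: JD|rewrite mulrDr addrACA].
- move=> _ y [j [b [Jj ->]]].
  by exists (j * y), (b * y); split; [exact: JM|rewrite mulrDl mulrA].
Qed.

Lemma ideal_scalarM J z w U V : right_ideal J -> central U ->
  J (1 - iota z * U) -> J (1 - iota w * V) -> J (1 - iota (z * w) * (U * V)).
Proof.
move=> Ji Uc JU JV; have [_ JD _] := Ji.
have -> : iota (z * w) * (U * V) = (iota z * U) * (iota w * V).
  by rewrite rmorphM -!mulrA; congr (_ * _); rewrite !mulrA iotaC.
have -> : 1 - iota z * U * (iota w * V) =
    1 - iota z * U + iota z * U * (1 - iota w * V).
  by rewrite mulrBr mulr1 addrA subrK.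
by apply: JD => //; apply: central_ideal => //; exact: central_iotaM.
Qed.

Lemma ideal_scalarV J z w U V : right_ideal J -> z * w = 1 -> U * V = 1 ->
  J (1 - iota z * U) -> J (1 - iota w * V).
Proof.
move=> Ji zw UV JU; have [_ _ JM] := Ji.
have e : (iota z * U) * (iota w * V) = 1.
  rewrite -mulrA [U * _]mulrA -[U * iota w]iotaC -!mulrA UV mulr1.
  by rewrite -rmorphM zw rmorph1.
have -> : 1 - iota w * V = - ((1 - iota z * U) * (iota w * V)).
  by rewrite mulrBl mul1r e opprB.
exact/(idealN Ji)/JM.
Qed.

(** Finitely many commuting central units can be evaluated simultaneously: this
    plays the part of a character of the commutative algebra that they
    generate. *)
Lemma joint_spectrum (I : eqType) (U V : I -> A) J (r : seq I) :
  (forall i, [/\ central (U i), U i * V i = 1, subexponential (U i)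
      & subexponential (V i)]) ->
  right_ideal J -> ~ J 1 ->
  exists z : I -> R[i], exists J', [/\ right_ideal J', ~ J' 1,
    forall x, J x -> J' x, forall i, normc (z i) = 1 &
    forall i, i \in r -> J' (1 - iota (z i) * U i)].
Proof.
move=> hU Ji J1; elim: r => [|i r [z [J' [J'i J'1 JJ' z1 zr]]]].
  by exists (fun=> 1), J; split=> // _; exact: normc1.
have [Uc UV Ug Vg] := hU i.
have [w w1 hw] := circle_spectrum J'i Uc UV Ug Vg J'1.
have incl x : J' x -> exists j b, J' j /\ x = j + (1 - iota w * U i) * b.
  by move=> J'x; exists x, 0; rewrite mulr0 addr0.
exists (fun k => if k == i then w else z k), (fun x =>
    exists j b, J' j /\ x = j + (1 - iota w * U i) * b).
split=> //; first exact: ideal_extend.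
- by move=> x /JJ'; exact: incl.
- by move=> k; case: eqP.
- move=> k; rewrite inE; have [-> _|ki /= kr] := eqVneq k i; last exact/incl/zr.
  by exists 0, 1; rewrite mulr1 add0r; case: J'i.
Qed.

End ProperRightIdeals.

(** * Bounded operators in a commutant *)

Lemma rapid_limit_unique (R : realType) (V : lmodType R[i]) (N : banach_norm V)
    (w : nat -> V) y y' (d d' : R) :
  (forall k, N (y - w k) <= d * 2^-1 ^+ k) ->
  (forall k, N (y' - w k) <= d' * 2^-1 ^+ k) -> y = y'.
Proof.
move=> hy hy'; apply/eqP; rewrite -subr_eq0; apply/eqP/(bnorm_le0 (b := N)).
apply: (@le_half_pow R _ 0 (d + d')) => k0; exists k0 => //.
have := bnorm_trans N y (w k0) y'; have := hy k0; have := hy' k0.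
rewrite (bnorm_distC N (w k0) y') add0r mulrDl; lra.
Qed.

Section Operators.
Variables (R : realType) (V : lmodType R[i]) (N : banach_norm V).
Variables (I : Type) (U : I -> {linear V -> V}).

Definition commuting_bounded : {pred V -> V} := fun T =>
  `[< [/\ linear T, exists c, forall x, N (T x) <= c * N x
      & forall i x, T (U i x) = U i (T x)] >].

Lemma commuting_boundedP T : reflect
  [/\ linear T, exists c, forall x, N (T x) <= c * N x
      & forall i x, T (U i x) = U i (T x)] (T \in commuting_bounded).
Proof. exact: asboolP. Qed.

Lemma commuting_bounded_submod : submod_closed commuting_bounded.
Proof.
split=> [|a S T /commuting_boundedP[lS [c hc] US] /commuting_boundedP[lT [d
    hd] UT]].
  apply/commuting_boundedP; split=> [a x y||i x].
  - by rewrite scaler0 addr0.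
  - by exists 0 => x; rewrite mul0r bnorm0.
  - by rewrite linear0.
apply/commuting_boundedP; split=> [b x y||i x].
- rewrite !fctE lS lT !scalerDr !scalerA (mulrC a) addrACA.
  by rewrite -!scalerA.
- exists (normc a * c + d) => x; rewrite !fctE.
  apply: le_trans (bnormD _ _ _) _; rewrite mulrDl lerD// bnormZ -mulrA.
  by rewrite ler_wpM2l// hc.
- by rewrite !fctE US UT linearP.
Qed.

HB.instance Definition _ := GRing.isSubmodClosed.Build R[i] (V -> V)
  commuting_bounded commuting_bounded_submod.

Record cop := Cop { cop_fun :> V -> V; _ : cop_fun \in commuting_bounded }.
HB.instance Definition _ := [isSub for cop_fun].
HB.instance Definition _ := [Choice of cop by <:].
HB.instance Definition _ := [SubChoice_isSubLmodule of cop by <:].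

Lemma copP (S T : cop) : (forall x, S x = T x) -> S = T.
Proof. by move=> ST; apply/val_inj/funext. Qed.

Lemma cop_spec (T : cop) : [/\ linear T, exists c, forall x, N (T x) <= c * N x
  & forall i x, T (U i x) = U i (T x)].
Proof. by apply/commuting_boundedP; case: T. Qed.

Lemma cop_linear (T : cop) : linear T. Proof. by case: (cop_spec T). Qed.

Definition cop_lin (T : cop) : {linear V -> V} :=
  HB.pack (T : V -> V) (GRing.isLinear.Build _ _ _ _ _ (cop_linear T)).

Lemma cop0 (T : cop) : T 0 = 0. Proof. exact: linear0 (cop_lin T). Qed.
Lemma copD (T : cop) x y : T (x + y) = T x + T y.
Proof. exact: linearD (cop_lin T) x y. Qed.
Lemma copZ (T : cop) a x : T (a *: x) = a *: T x.
Proof. exact: linearZZ (cop_lin T) a x. Qed.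

Lemma cop_addE (S T : cop) x : (S + T) x = S x + T x. Proof. by []. Qed.
Lemma cop_scaleE a (S : cop) x : (a *: S) x = a *: S x. Proof. by []. Qed.
Lemma cop_zeroE x : (0 : cop) x = 0. Proof. by []. Qed.

Lemma commuting_bounded_comp (S T : cop) : S \o T \in commuting_bounded.
Proof.
have [lS [c hc] US] := cop_spec S; have [lT [d hd] UT] := cop_spec T.
apply/commuting_boundedP; split=> [a x y||i x] /=.
- by rewrite lT lS.
- exists (`|c| * d) => x; apply: le_trans (hc _) _; rewrite -mulrA.
  apply: (@le_trans _ _ (`|c| * N (T x))).
    by rewrite ler_wpM2r ?bnorm_ge0 ?ler_norm.
  by rewrite ler_wpM2l// hd.
- by rewrite UT US.
Qed.

Lemma commuting_bounded_id : id \in commuting_bounded.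
Proof.
by apply/commuting_boundedP; split=> //; exists 1 => x; rewrite mul1r.
Qed.

Definition cop_mul (S T : cop) := Cop (commuting_bounded_comp S T).
Definition cop_one := Cop commuting_bounded_id.

Fact cop_mulA : associative cop_mul. Proof. by move=> *; exact: copP. Qed.
Fact cop_mul1r : left_id cop_one cop_mul. Proof. by move=> *; exact: copP. Qed.
Fact cop_mulr1 : right_id cop_one cop_mul. Proof. by move=> *; exact: copP. Qed.
Fact cop_mulDl : left_distributive cop_mul +%R.
Proof. by move=> *; exact: copP. Qed.
Fact cop_mulDr : right_distributive cop_mul +%R.
Proof. by move=> S T T'; apply: copP => x; exact: copD. Qed.

HB.instance Definition _ := GRing.Zmodule_isPzRing.Build cop
  cop_mulA cop_mul1r cop_mulr1 cop_mulDl cop_mulDr.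

Lemma cop_mulE (S T : cop) x : (S * T) x = S (T x). Proof. by []. Qed.
Lemma cop_oneE x : (1 : cop) x = x. Proof. by []. Qed.

Lemma cop_scalerAl a (S T : cop) : a *: (S * T) = (a *: S) * T.
Proof. exact: copP. Qed.
Lemma cop_scalerAr a (S T : cop) : a *: (S * T) = S * (a *: T).
Proof. by apply: copP => x; rewrite !cop_scaleE !cop_mulE cop_scaleE copZ. Qed.

Definition opN (T : cop) : R :=
  inf [set c : R | 0 <= c /\ forall x, N (T x) <= c * N x].

Lemma opN_ge0 (T : cop) : 0 <= opN T.
Proof.
have [_ [c hc] _] := cop_spec T.
apply: lb_le_inf => [|d [] //]; exists `|c|; split=> // x.
by apply: le_trans (hc x) _; rewrite ler_wpM2r ?bnorm_ge0 ?ler_norm.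
Qed.

Lemma opN_le (T : cop) (c : R) : 0 <= c -> (forall x, N (T x) <= c * N x) ->
    opN T <= c.
Proof. by move=> c0 hc; apply: ge_inf; [exists 0 => d []|split]. Qed.

Lemma opN_bound (T : cop) x : N (T x) <= opN T * N x.
Proof.
have [->|x0] := eqVneq x 0; first by rewrite cop0 bnorm0 mulr0.
have Nx : 0 < N x.
  rewrite lt_neqAle bnorm_ge0 andbT eq_sym; apply: contra x0 => /eqP Nx.
  by apply/eqP/(bnorm_le0 (b := N)); rewrite Nx.
rewrite -ler_pdivrMr//; have [_ [c hc] _] := cop_spec T.
apply: lb_le_inf => [|d [_ hd]]; last by rewrite ler_pdivrMr.
exists `|c|; split=> // y.
by apply: le_trans (hc y) _; rewrite ler_wpM2r ?bnorm_ge0 ?ler_norm.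
Qed.

Lemma opND (S T : cop) : opN (S + T) <= opN S + opN T.
Proof.
apply: opN_le => [|x]; first by rewrite addr_ge0 ?opN_ge0.
rewrite cop_addE; apply: le_trans (bnormD _ _ _) _.
by rewrite mulrDl lerD ?opN_bound.
Qed.

Lemma opNZ_le a (T : cop) : opN (a *: T) <= normc a * opN T.
Proof.
apply: opN_le => [|x]; first by rewrite mulr_ge0 ?opN_ge0.
by rewrite cop_scaleE bnormZ -mulrA ler_wpM2l ?opN_bound.
Qed.

Lemma opN_le0 (T : cop) : opN T <= 0 -> T = 0.
Proof.
move=> T0; apply: copP => x; rewrite cop_zeroE; apply: (bnorm_le0 (b := N)).
by apply: le_trans (opN_bound T x) _; rewrite mulr_le0_ge0 ?bnorm_ge0.
Qed.

Lemma opNM (S T : cop) : opN (S * T) <= opN S * opN T.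
Proof.
apply: opN_le => [|x]; first by rewrite mulr_ge0 ?opN_ge0.
rewrite cop_mulE; apply: le_trans (opN_bound _ _) _.
by rewrite -mulrA ler_wpM2l ?opN_ge0 ?opN_bound.
Qed.

Lemma opN1 : opN 1 <= 1.
Proof. by apply: opN_le => // x; rewrite mul1r. Qed.

Hypothesis U_bounded : forall i, exists c, forall x, N (U i x) <= c * N x.

Lemma opN_complete (u : nat -> cop) :
  (forall k, opN (u k.+1 - u k) <= 2^-1 ^+ k) ->
  exists s : cop, forall k, opN (s - u k) <= 2 * 2^-1 ^+ k.
Proof.
move=> hu; have p0 k : 0 <= 2^-1 ^+ k :> R by rewrite exprn_ge0 ?invr_ge0.
have /choice[s hs] : forall x, exists y,
    forall k, N (y - u k x) <= 2 * N x * 2^-1 ^+ k.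
  move=> x; apply: (@bnorm_completeZ _ _ _ _ (fun k => u k x)) => [|k].
    exact: bnorm_ge0.
  apply: le_trans (opN_bound (u k.+1 - u k) x) _.
  by rewrite mulrC ler_wpM2l ?bnorm_ge0.
have sP : s \in commuting_bounded.
  apply/commuting_boundedP; split=> [a x y||i x].
  - apply: (rapid_limit_unique (hs _)) => k; rewrite cop_linear opprD addrACA.
    rewrite -scalerBr; apply: le_trans (bnormD _ _ _) _.
    rewrite bnormZ; apply: (@le_trans _ _
      ((normc a * (2 * N x) + 2 * N y) * 2^-1 ^+ k)); last exact: lexx.
    by rewrite mulrDl -mulrA lerD ?ler_wpM2l ?hs.
  - exists (2 + opN (u 0%N)) => x; have := hs x 0%N.
    have := opN_bound (u 0%N) x; have := bnormD N (s x - u 0%N x) (u 0%N x).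
    by rewrite subrK expr0 mulr1 mulrDl; lra.
  - have [c hc] := U_bounded i.
    apply: (rapid_limit_unique (hs _)) => k.
    have [_ _ ->] := cop_spec (u k); rewrite -linearB.
    apply: (@le_trans _ _ (`|c| * (2 * N x) * 2^-1 ^+ k)); last exact: lexx.
    apply: le_trans (hc _) _; rewrite -mulrA.
    apply: (@le_trans _ _ (`|c| * N (s x - u k x))).
      by rewrite ler_wpM2r ?bnorm_ge0 ?ler_norm.
    by rewrite ler_wpM2l ?hs.
exists (Cop sP) => k; apply: opN_le => [|x]; first by rewrite mulr_ge0.
by rewrite mulrAC; exact: hs.
Qed.

Definition cop_norm : banach_norm cop :=
  BanachNorm opND opNZ_le opN_le0 opN_complete.

(** The Neumann series of [1 - c]; its ratio 1/2 is that of rapidly Cauchy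
    sequences. *)
Lemma cop_inv_near1 (c : cop) : opN (1 - c) <= 2^-1 ->
    exists d : cop, c * d = 1.
Proof.
move=> hc; pose x := 1 - c; pose u k := \sum_(i < k) x ^+ i.
have xk k : opN (x ^+ k) <= 2^-1 ^+ k.
  elim: k => [|k IH]; first by rewrite !expr0 opN1.
  by rewrite !exprS; apply: le_trans (opNM _ _) _; rewrite ler_pM ?opN_ge0.
have cu k : c * u k = 1 - x ^+ k.
  elim: k => [|k IH]; first by rewrite /u big_ord0 mulr0 expr0 subrr.
  rewrite /u big_ord_recr/= mulrDr -/(u k) IH exprS.
  have -> : c = 1 - x by rewrite opprB addrC subrK.
  by rewrite mulrBl mul1r addrA subrK.
have [k|s hs] := @opN_complete u;
    first by rewrite /u big_ord_recr/= addrAC subrr add0r; exact: xk.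
exists s; apply: (@rapid_limit_unique _ _ cop_norm (fun k =>
    c * u k) _ _ (opN c * 2) 1) => k.
  by rewrite -mulrBr; apply: le_trans (opNM _ _) _;
      rewrite -mulrA ler_wpM2l ?opN_ge0.
by rewrite cu opprB addrC subrK mul1r.
Qed.

Definition cop_scalar (z : R[i]) : cop := z *: cop_one.

Fact cop_scalar_zmod : zmod_morphism cop_scalar.
Proof. by move=> a b; rewrite /cop_scalar scalerBl. Qed.
Fact cop_scalar_monoid : monoid_morphism cop_scalar.
Proof.
split=> [|a b]; first by rewrite /cop_scalar scale1r.
by rewrite /cop_scalar -cop_scalerAl mul1r scalerA.
Qed.
HB.instance Definition _ := GRing.isZmodMorphism.Build _ _ cop_scalar
    cop_scalar_zmod.
HB.instance Definition _ := GRing.isMonoidMorphism.Build _ _ cop_scalar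
    cop_scalar_monoid.

Lemma cop_scalarE z (T : cop) : cop_scalar z * T = z *: T.
Proof. by rewrite /cop_scalar -cop_scalerAl mul1r. Qed.

Lemma cop_scalarC z (T : cop) : cop_scalar z * T = T * cop_scalar z.
Proof. by rewrite cop_scalarE /cop_scalar -cop_scalerAr mulr1. Qed.

End Operators.

(** * The complete spaces involved *)

Definition nsum (R : realType) (I : choiceType) (f : I -> R) : R :=
  fine (\esum_(i in [set: I]) (f i)%:E).

Section NonnegativeSum.
Variables (R : realType) (I : choiceType) (f : I -> R).
Hypothesis f0 : forall i, 0 <= f i.

Lemma sum_le_nsum c : sum_le f c -> sum_le f (nsum f).
Proof. by move=> fc; apply: sum_le_fine => //; exact: sum_le_ltoo fc. Qed.

Lemma nsum_le c : sum_le f c -> nsum f <= c.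
Proof.
move=> fc; rewrite -lee_fin /nsum fineK ?esum_sum_le//.
rewrite ge0_fin_numE ?(sum_le_ltoo fc)//.
by apply: esum_ge0 => i _; rewrite lee_fin.
Qed.

Lemma nsum_ge0 : 0 <= nsum f.
Proof. by rewrite fine_ge0// esum_ge0// => i _; rewrite lee_fin. Qed.

End NonnegativeSum.

Section RapidSequences.
Variables (R : realType) (V : zmodType) (N : V -> R).
Hypothesis ND : forall x y, N (x + y) <= N x + N y.
Hypothesis N0 : N 0 <= 0.

Lemma rapid_dist (u : nat -> V) : (forall k, N (u k.+1 - u k) <= 2^-1 ^+ k) ->
  forall k m, (k <= m)%N -> N (u m - u k) <= 2 * 2^-1 ^+ k.
Proof.
move=> hu k m km.
have p0 i : 0 <= 2^-1 ^+ i :> R by rewrite exprn_ge0 ?invr_ge0.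
suff h i : N (u (k + i)%N - u k) <= 2 * 2^-1 ^+ k - 2 * 2^-1 ^+ (k + i).
  have := h (m - k)%N; rewrite subnKC//; have := p0 m; lra.
elim: i => [|i IH]; first by rewrite addn0 !subrr.
have := ND (u (k + i).+1 - u (k + i)%N) (u (k + i)%N - u k).
rewrite addrA subrK addnS; have := hu (k + i)%N; rewrite exprS; lra.
Qed.

(** Comparing with [u m] for large [m] removes the constant [d]. *)
Lemma rapid_limit (u : nat -> V) (s : V) (d : R) :
  (forall k, N (u k.+1 - u k) <= 2^-1 ^+ k) ->
  (forall k, N (s - u k) <= d * 2^-1 ^+ k) ->
  forall k, N (s - u k) <= 2 * 2^-1 ^+ k.
Proof.
move=> hu hs k; apply: (@le_half_pow R _ _ d) => k0.
exists (maxn k k0); rewrite ?leq_maxr//.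
have := rapid_dist hu (leq_maxl k k0); have := hs (maxn k k0).
by have := ND (s - u (maxn k k0)) (u (maxn k k0) - u k); rewrite addrA subrK;
    lra.
Qed.

End RapidSequences.

(** The limit is the supremum of the nondecreasing sequence [u k - 2 * 2^-k]. *)
Lemma real_complete (R : realType) (u : nat -> R) :
  (forall k, `|u k.+1 - u k| <= 2^-1 ^+ k) ->
  exists s, forall k, `|s - u k| <= 2 * 2^-1 ^+ k.
Proof.
move=> hu; have p0 i : 0 <= 2^-1 ^+ i :> R by rewrite exprn_ge0 ?invr_ge0.
have dist := rapid_dist (@ler_normD R R) _ hu.
have {}dist k m : u m - 2 * 2^-1 ^+ m <= u k + 2 * 2^-1 ^+ k.
  have [km|/ltnW mk] := leqP k m.
    have := dist _ _ _ km; rewrite normr0 ler_norml => /(_ (lexx _)) /andP[_].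
    by have := p0 m; lra.
  have := dist _ _ _ mk; rewrite normr0 ler_norml => /(_ (lexx _)) /andP[+ _].
  by have := p0 k; lra.
pose E := [set u m - 2 * 2^-1 ^+ m | m in [set: nat]].
have E0 : E !=set0 by exists (u 0%N - 2 * 2^-1 ^+ 0), 0%N.
exists (sup E) => k; rewrite ler_norml; apply/andP; split.
  have : u k - 2 * 2^-1 ^+ k <= sup E.
    apply: sup_upper_bound; last by exists k.
    by split=> //; exists (u 0%N + 2 * 2^-1 ^+ 0) => _ [m _ <-]; exact: dist.
  lra.
have : sup E <= u k + 2 * 2^-1 ^+ k.
  by apply: ge_sup => // _ [m _ <-]; exact: dist.
lra.
Qed.

Section ComplexNorm.
Variable R : realType.

Lemma ler_normc_Re (z : R[i]) : `|complex.Re z| <= normc z.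
Proof.
case: z => a b; rewrite /normc/= -sqrtr_sqr ler_wsqrtr//.
by rewrite lerDl sqr_ge0.
Qed.

Lemma ler_normc_Im (z : R[i]) : `|complex.Im z| <= normc z.
Proof.
case: z => a b; rewrite /normc/= -sqrtr_sqr ler_wsqrtr//.
by rewrite lerDr sqr_ge0.
Qed.

Lemma normc_complete (u : nat -> R[i]) :
  (forall k, normc (u k.+1 - u k) <= 2^-1 ^+ k) ->
  exists s, forall k, normc (s - u k) <= 2 * 2^-1 ^+ k.
Proof.
move=> hu.
have [k|a ha] := @real_complete R (fun k => complex.Re (u k)).
  by apply: le_trans (hu k); have := ler_normc_Re (u k.+1 - u k);
      rewrite raddfB.
have [k|b hb] := @real_complete R (fun k => complex.Im (u k)).
  by apply: le_trans (hu k); have := ler_normc_Im (u k.+1 - u k);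
      rewrite raddfB.
exists (Complex a b); apply: (@rapid_limit R R[i] _ _ _ _ _ 4) => //.
- exact: le_normcD.
- by rewrite normc0.
move=> k; have ->
    : Complex a b - u k = Complex (a - complex.Re (u k)) (b - complex.Im (u k)).
  by case: (u k).
apply: le_trans (normc_Complex _ _) _; have := ha k; have := hb k; lra.
Qed.

Lemma normcZ_le (a : R[i]) (x : R[i]^o) : normc (a *: x) <= normc a * normc x.
Proof. by rewrite -normcM. Qed.

Lemma normc_le0 (x : R[i]^o) : normc x <= 0 -> x = 0.
Proof. by move=> x0; apply: eq0_normc; apply/eqP;
    rewrite eq_le x0 normc_ge0. Qed.

Definition complex_norm : banach_norm R[i]^o :=
  @BanachNorm R R[i]^o (@normc R) (@le_normcD R) normcZ_le normc_le0
      normc_complete.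

End ComplexNorm.

Section SquareSummable.
Variables (R : realType) (n : nat).
Implicit Types g h : ell2 R n.

Lemma ell2_addE g h x : (g + h) x = g x + h x. Proof. by []. Qed.
Lemma ell2_scaleE a g x : (a *: g) x = a * g x. Proof. by []. Qed.

Definition nrm2 g : R := Num.sqrt (nsum (fun x => normc (g x) ^+ 2)).

Lemma ell2_intro (f : 'rV[int]_n -> R[i]) c :
  sum_le (fun x => normc (f x) ^+ 2) c -> f \in @square_summable R n.
Proof. by move=> fc; rewrite square_summableE; exact: sum_le_ltoo fc. Qed.

Lemma nrm2_ge0 g : 0 <= nrm2 g. Proof. exact: sqrtr_ge0. Qed.

Lemma nrm2_sum g : sum_le (fun x => normc (g x) ^+ 2) (nrm2 g ^+ 2).
Proof.
have g0 x : 0 <= normc (g x) ^+ 2 by rewrite exprn_ge0.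
rewrite /nrm2 sqr_sqrtr ?nsum_ge0//; apply: sum_le_fine => //.
by rewrite -square_summableE; case: g {g0}.
Qed.

Lemma nrm2_le g c : 0 <= c -> sum_le (fun x => normc (g x) ^+ 2) (c ^+ 2) ->
  nrm2 g <= c.
Proof.
move=> c0 gc; rewrite -[c]ger0_norm// -sqrtr_sqr ler_wsqrtr//.
by apply: nsum_le gc => x; rewrite exprn_ge0.
Qed.

Lemma l2normE g : l2norm g = (nrm2 g)%:E.
Proof.
rewrite /l2norm /nrm2 /nsum.
have : (\esum_(x in [set: 'rV[int]_n]) (normc (g x) ^+ 2)%:E < +oo)%E.
  by rewrite -square_summableE; case: g.
have : (0 <= \esum_(x in [set: 'rV[int]_n]) (normc (g x) ^+ 2)%:E)%E.
  by apply: esum_ge0 => x _; rewrite lee_fin exprn_ge0.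
by case: (\esum_(x in _) _)%E.
Qed.

Lemma nrm2_coord g x : normc (g x) <= nrm2 g.
Proof.
rewrite -(@ler_pXn2r _ 2)// ?nnegrE ?nrm2_ge0//.
exact: (sum_le_term x (nrm2_sum g)).
Qed.

Lemma nrm2_le0 g : nrm2 g <= 0 -> g = 0.
Proof.
move=> g0; apply/val_inj/funext => x; apply: eq0_normc; apply/eqP.
by rewrite eq_le normc_ge0 andbT (le_trans (nrm2_coord g x)).
Qed.

Lemma nrm2Z_le a g : nrm2 (a *: g) <= normc a * nrm2 g.
Proof.
apply: nrm2_le => [|s us]; first by rewrite mulr_ge0 ?nrm2_ge0.
rewrite exprMn; apply: le_trans (sum_leZ _ (nrm2_sum g) us);
    last exact: exprn_ge0.
by apply: ler_sum => x _; rewrite -exprMn -normcM.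
Qed.

(** Minkowski's inequality, by the weighted inequality (s + t)^2 <= (1 + b / a)
    s^2 + (1 + a / b) t^2 for a and b the two norms. *)
Lemma nrm2D g h : nrm2 (g + h) <= nrm2 g + nrm2 h.
Proof.
have [/nrm2_le0 ->|a0] := leP (nrm2 g) 0; first by rewrite add0r lerDr nrm2_ge0.
have [/nrm2_le0 ->|b0] := leP (nrm2 h) 0; first by rewrite addr0 lerDl nrm2_ge0.
set a := nrm2 g in a0 *; set b := nrm2 h in b0 *.
have ba : 0 <= 1 + b / a by rewrite addr_ge0 ?divr_ge0 ?ltW.
have ab : 0 <= 1 + a / b by rewrite addr_ge0 ?divr_ge0 ?ltW.
apply: nrm2_le => [|s us]; first by rewrite addr_ge0 ?ltW.
have := sum_leD (sum_leZ ba (nrm2_sum g)) (sum_leZ ab (nrm2_sum h)) us.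
rewrite -/a -/b.
have -> : (1 + b / a) * a ^+ 2 + (1 + a / b) * b ^+ 2 = (a + b) ^+ 2.
  by field; rewrite !gt_eqF.
apply: le_trans; apply: ler_sum => x _.
have nD : normc ((g + h) x) ^+ 2 <= (normc (g x) + normc (h x)) ^+ 2.
  by rewrite lerXn2r ?nnegrE ?addr_ge0//; exact: le_normcD.
apply: le_trans nD _; rewrite -subr_ge0.
set p := normc (g x); set q := normc (h x).
have -> : (1 + b / a) * p ^+ 2 + (1 + a / b) * q ^+ 2 - (p + q) ^+ 2 =
   (b * p - a * q) ^+ 2 / (a * b) by field; rewrite !gt_eqF.
by rewrite divr_ge0 ?sqr_ge0// mulr_ge0// ltW.
Qed.

(** The limit is taken coordinatewise, and the norm of the remainder is bounded
    on each finite set, where the error of the coordinates is negligible. *)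
Lemma nrm2_complete (u : nat -> ell2 R n) :
  (forall k, nrm2 (u k.+1 - u k) <= 2^-1 ^+ k) ->
  exists s, forall k, nrm2 (s - u k) <= 2 * 2^-1 ^+ k.
Proof.
move=> hu; have p0 i : 0 <= 2^-1 ^+ i :> R by rewrite exprn_ge0 ?invr_ge0.
have p1 i : 2^-1 ^+ i <= 1 :> R
    by rewrite exprn_ile1 ?invr_ge0// invf_le1// ler1n.
have /choice[f hf] : forall x, exists y, forall k,
    normc (y - u k x) <= 2 * 2^-1 ^+ k.
  move=> x; apply: (@normc_complete R (fun k => u k x)) => k.
  exact: le_trans (nrm2_coord (u k.+1 - u k) x) (hu k).
have N00 : nrm2 0 <= 0.
  by apply: nrm2_le => // s us; rewrite big1 ?expr0n// => x _;
      rewrite normc0 expr0n.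
have dist := rapid_dist nrm2D N00 hu.
have fk k : sum_le (fun x => normc (f x - u k x) ^+ 2) ((2 * 2^-1 ^+ k) ^+ 2).
  move=> s us; set c := 2 * 2^-1 ^+ k.
  apply: (@le_half_pow R _ _ ((size s)%:R * ((2 * c + 2) * 2))) => k0.
  exists (maxn k k0); rewrite ?leq_maxr//; set m := maxn k k0.
  have c0 : 0 <= c by rewrite mulr_ge0.
  have step x : normc (f x - u k x) ^+ 2 <=
      normc ((u m - u k) x) ^+ 2 + (2 * c + 2) * 2 * 2^-1 ^+ m.
    have h1 : normc (f x - u k x) <= normc ((u m - u k) x) + 2 * 2^-1 ^+ m.
      have := le_normcD (f x - u m x) (u m x - u k x); rewrite addrA subrK.
      by have := hf x m; rewrite -[(u m - u k) x]/(u m x - u k x); lra.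
    have h2 : normc ((u m - u k) x) <= c.
      by apply: le_trans (nrm2_coord _ _) _; apply: dist; exact: leq_maxl.
    have := p0 m; have := p1 m; move: h1 h2.
    set q := 2^-1 ^+ m; set a := normc (f x - _); set b := normc ((u m - _) x).
    move=> h1 h2 q1 q0; have b0 : 0 <= b by exact: normc_ge0.
    have a2 : a ^+ 2 <= (b + 2 * q) ^+ 2.
      by rewrite lerXn2r ?nnegrE ?addr_ge0 ?mulr_ge0//; exact: normc_ge0.
    apply: le_trans a2 _; rewrite sqrrD -addrA lerD2l.
    have e1 : b * q <= c * q by rewrite ler_wpM2r.
    have e2 : q * q <= 1 * q by rewrite ler_wpM2r.
    by rewrite expr2; nra.
  apply: (@le_trans _ _ (\sum_(x <- s) (normc ((u m - u k) x) ^+ 2 + (2 * c +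
      2) * 2 * 2^-1 ^+ m))).
    by apply: ler_sum => x _; exact: step.
  rewrite big_split/= big_const_seq count_predT iter_addr_0 -[_ *+ size
      s]mulr_natl.
  rewrite -[X in _ <= _ + X]mulrA lerD2r.
  apply: le_trans (nrm2_sum (u m - u k) us) _.
  by rewrite lerXn2r ?nnegrE ?nrm2_ge0//; apply: dist; exact: leq_maxl.
pose s0 : ell2 R n := Ell2 (ell2_intro (fk 0%N)).
exists (s0 + u 0%N) => k; apply: nrm2_le; first by rewrite mulr_ge0.
apply: sum_le_mono (fk k) => x.
by rewrite -[(s0 + u 0%N - u k) x]/(f x - u 0%N x + u 0%N x - u k x) subrK.
Qed.

Definition ell2_norm : banach_norm (ell2 R n) :=
  BanachNorm nrm2D nrm2Z_le nrm2_le0 nrm2_complete.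

End SquareSummable.

(** For a submultiplicative weight, symmetry serves to give the lower bound 1:
    one has 1 <= v 0 <= v x * v (- x) = v x ^+ 2. *)
Record weight (R : realType) (G : zmodType) := Weight {
  wt :> G -> R;
  wt_ge1 : forall x, 1 <= wt x;
  wt_submul : forall x y, wt (x + y) <= wt x * wt y }.

Section WeightedSpace.
Variables (R : realType) (G : zmodType) (w : weight R G).
Variables (V : lmodType R[i]) (N : banach_norm V).
Implicit Types xi eta : G -> V.

Lemma wt_ge0 x : 0 <= w x. Proof. exact: le_trans (wt_ge1 w x). Qed.

Lemma wterm_ge0 xi x : 0 <= w x * N (xi x).
Proof. by rewrite mulr_ge0 ?wt_ge0 ?bnorm_ge0. Qed.

Definition wsummable : {pred G -> V} := fun xi =>
  `[< exists c, sum_le (fun x => w x * N (xi x)) c >].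

Lemma wsummableP xi :
  reflect (exists c, sum_le (fun x => w x * N (xi x)) c) (xi \in wsummable).
Proof. exact: asboolP. Qed.

Lemma sum_le_wtD xi eta c d : sum_le (fun x => w x * N (xi x)) c ->
  sum_le (fun x => w x * N (eta x)) d ->
  sum_le (fun x => w x * N (xi x + eta x)) (c + d).
Proof.
move=> hc hd; apply: sum_le_mono (sum_leD hc hd) => x.
by rewrite -mulrDr ler_wpM2l ?wt_ge0 ?bnormD.
Qed.

Lemma sum_le_wtZ a xi c : sum_le (fun x => w x * N (xi x)) c ->
  sum_le (fun x => w x * N (a *: xi x)) (normc a * c).
Proof.
move=> hc; apply: sum_le_mono (sum_leZ (normc_ge0 a) hc) => x.
by rewrite bnormZ mulrCA.
Qed.

Lemma wsummable_submod : submod_closed wsummable.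
Proof.
split=> [|a xi eta /wsummableP[c hc] /wsummableP[d hd]]; apply/wsummableP.
  by exists 0 => s us; rewrite big1// => x _; rewrite bnorm0 mulr0.
by exists (normc a * c + d); apply: sum_le_wtD => //; exact: sum_le_wtZ.
Qed.

HB.instance Definition _ := GRing.isSubmodClosed.Build R[i] (G -> V)
  wsummable wsummable_submod.

Record wl1 := WL1 { wl1_fun :> G -> V; _ : wl1_fun \in wsummable }.
HB.instance Definition _ := [isSub for wl1_fun].
HB.instance Definition _ := [Choice of wl1 by <:].
HB.instance Definition _ := [SubChoice_isSubLmodule of wl1 by <:].

Lemma wl1P (xi eta : wl1) : (forall x, xi x = eta x) -> xi = eta.
Proof. by move=> h; apply/val_inj/funext. Qed.

Lemma wl1_addE (xi eta : wl1) x : (xi + eta) x = xi x + eta x.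
Proof. by []. Qed.
Lemma wl1_scaleE a (xi : wl1) x : (a *: xi) x = a *: xi x. Proof. by []. Qed.

Definition wl1N (xi : wl1) : R := nsum (fun x => w x * N (xi x)).

Lemma wl1N_sum (xi : wl1) : sum_le (fun x => w x * N (xi x)) (wl1N xi).
Proof.
have [c hc] : exists c, sum_le (fun x => w x * N (xi x)) c.
  by apply/wsummableP; case: xi.
by apply: sum_le_nsum hc => x; exact: wterm_ge0.
Qed.

Lemma wl1N_le (xi : wl1) c : sum_le (fun x => w x * N (xi x)) c -> wl1N xi <= c.
Proof. by apply: nsum_le => x; exact: wterm_ge0. Qed.

Lemma wl1N_coord (xi : wl1) x : N (xi x) <= wl1N xi.
Proof.
apply: le_trans (sum_le_term x (wl1N_sum xi)).
by rewrite -{1}[N _]mul1r ler_wpM2r ?bnorm_ge0 ?wt_ge1.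
Qed.

Lemma wl1ND (xi eta : wl1) : wl1N (xi + eta) <= wl1N xi + wl1N eta.
Proof. by apply: wl1N_le; apply: sum_le_wtD; exact: wl1N_sum. Qed.

Lemma wl1NZ_le a (xi : wl1) : wl1N (a *: xi) <= normc a * wl1N xi.
Proof. by apply: wl1N_le; apply: sum_le_wtZ; exact: wl1N_sum. Qed.

Lemma wl1N_le0 (xi : wl1) : wl1N xi <= 0 -> xi = 0.
Proof.
move=> x0; apply: wl1P => x; apply: (bnorm_le0 (b := N)).
exact: le_trans (wl1N_coord xi x) x0.
Qed.

Lemma wl1N_complete (u : nat -> wl1) :
  (forall k, wl1N (u k.+1 - u k) <= 2^-1 ^+ k) ->
  exists s : wl1, forall k, wl1N (s - u k) <= 2 * 2^-1 ^+ k.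
Proof.
move=> hu; have p0 i : 0 <= 2^-1 ^+ i :> R by rewrite exprn_ge0 ?invr_ge0.
have /choice[f hf] : forall x, exists y, forall k,
    N (y - u k x) <= 2 * 2^-1 ^+ k.
  move=> x; apply: (@bnorm_complete R V N (fun k => u k x)) => k.
  exact: le_trans (wl1N_coord (u k.+1 - u k) x) (hu k).
have N00 : wl1N 0 <= 0.
  by apply: wl1N_le => s us; rewrite big1// => x _; rewrite bnorm0 mulr0.
have dist := rapid_dist wl1ND N00 hu.
have fk k : sum_le (fun x => w x * N (f x - u k x)) (2 * 2^-1 ^+ k).
  move=> s us; apply: (@le_half_pow R _ _ (2 * \sum_(x <- s) w x)) => k0.
  exists (maxn k k0); rewrite ?leq_maxr//; set m := maxn k k0.
  apply: (@le_trans _ _ (\sum_(x <- s) (w x * N ((u m - u k) x) + w x * (2 *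
      2^-1 ^+ m)))).
    apply: ler_sum => x _; rewrite -mulrDr ler_wpM2l ?wt_ge0//.
    rewrite -[(u m - u k) x]/(u m x - u k x).
    have := bnormD N (f x - u m x) (u m x - u k x); rewrite addrA subrK.
    by have := hf x m; lra.
  rewrite big_split/= -mulr_suml [2 * \sum_(_ <- _) _]mulrC -mulrA lerD2r.
  apply: le_trans (wl1N_sum (u m - u k) us) _.
  by apply: dist; exact: leq_maxl.
have s0P : (fun x => f x - u 0%N x) \in wsummable.
  by apply/wsummableP; exists (2 * 2^-1 ^+ 0); exact: fk.
exists (WL1 s0P + u 0%N) => k; apply: wl1N_le; apply: sum_le_mono (fk k) => x.
by rewrite -[(WL1 s0P + u 0%N - u k) x]/(f x - u 0%N x + u 0%N x - u k x) subrK.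
Qed.

Definition wl1_norm : banach_norm wl1 :=
  BanachNorm wl1ND wl1NZ_le wl1N_le0 wl1N_complete.

Lemma sum_le_trans y (xi : wl1) :
  sum_le (fun x => w x * N (xi (x - y))) (w y * wl1N xi).
Proof.
have := sum_leZ (wt_ge0 y) (wl1N_sum xi).
move=> /(sum_le_reindex (subrK y)); apply: sum_le_mono => x.
rewrite mulrA ler_wpM2r ?bnorm_ge0//.
by rewrite -{1}(subrK y x) addrC wt_submul.
Qed.

Fact translate_subproof y (xi : wl1) : (fun x => xi (x - y)) \in wsummable.
Proof. by apply/wsummableP; exists (w y * wl1N xi); exact: sum_le_trans. Qed.

Definition translate y (xi : wl1) : wl1 := WL1 (translate_subproof y xi).

Fact translate_linear y : linear (translate y).
Proof. by move=> a xi eta; exact: wl1P. Qed.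
HB.instance Definition _ y := GRing.isLinear.Build _ _ _ _ (translate y)
    (translate_linear y).

Lemma translate_bound y (xi : wl1) : wl1N (translate y xi) <= w y * wl1N xi.
Proof. by apply: wl1N_le; exact: sum_le_trans. Qed.

Definition translations (y : G) : {linear wl1 -> wl1} := translate y.

Lemma translations_bounded y :
  exists c, forall xi : wl1, wl1_norm (translations y xi) <= c * wl1_norm xi.
Proof. by exists (w y) => xi; exact: translate_bound. Qed.

(** Such an operator is convolution by an operator-valued kernel on [G],
    summable in the strong sense. The algebra contains the translations as
    central elements. *)
Definition tcop := cop wl1_norm translations.
Definition tcop_norm : banach_norm tcop := cop_norm translations_bounded.

Fact tr_subproof y : translate y \in commuting_bounded wl1_norm translations.
Proof.
apply/commuting_boundedP; split=> [|| z xi].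
- exact: translate_linear.
- exact: translations_bounded.
- by apply: wl1P => x /=; rewrite addrAC.
Qed.

Definition tr y : tcop := Cop (tr_subproof y).

Lemma tr_central y : central (tr y).
Proof.
by move=> T; apply: copP => xi; have [_ _ /(_ y xi) h] := cop_spec T;
    exact/esym/h.
Qed.

Lemma tr0 : tr 0 = 1.
Proof. by apply: copP => xi; apply: wl1P => x; rewrite /= subr0. Qed.

Lemma trD y z : tr (y + z) = tr y * tr z.
Proof. by apply: copP => xi; apply: wl1P => x; rewrite /= opprD addrA. Qed.

Lemma tr_norm y : tcop_norm (tr y) <= w y.
Proof. by apply: opN_le => [|xi]; [exact: wt_ge0|exact: translate_bound]. Qed.

(** Bounded operators, as the commutant of the empty family. *)
Definition no_commutant (W : lmodType R[i]) : void -> {linear W -> W} :=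
  fun i => match i with end.
Definition bop (W : lmodType R[i]) (M : banach_norm W) := cop M (no_commutant
    W).
Fact no_commutant_bounded (W : lmodType R[i]) (M : banach_norm W) (i : void) :
  exists c, forall x, M (no_commutant W i x) <= c * M x.
Proof. by case: i. Qed.
Definition bop_norm (W : lmodType R[i]) (M : banach_norm W) : banach_norm (bop
    M) :=
  cop_norm (no_commutant_bounded M).

Lemma sum_le_lift (T : bop N) (xi : wl1) :
  sum_le (fun x => w x * N (T (xi x))) (bop_norm N T * wl1N xi).
Proof.
apply: sum_le_mono (sum_leZ (opN_ge0 T) (wl1N_sum xi)) => x.
by rewrite mulrCA ler_wpM2l ?wt_ge0 ?opN_bound.
Qed.

Fact lift_fun_subproof (T : bop N) (xi : wl1) : (fun x =>
    T (xi x)) \in wsummable.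
Proof. by apply/wsummableP; exists (bop_norm N T * wl1N xi);
    exact: sum_le_lift. Qed.

Definition lift_fun (T : bop N) (xi : wl1) : wl1 := WL1 (lift_fun_subproof T
    xi).

Lemma lift_fun_bound T (xi : wl1) : wl1N (lift_fun T xi)
    <= bop_norm N T * wl1N xi.
Proof. by apply: wl1N_le; exact: sum_le_lift. Qed.

Fact lift_subproof (T : bop N) :
  lift_fun T \in commuting_bounded wl1_norm translations.
Proof.
apply/commuting_boundedP; split=> [a xi eta||z xi].
- by apply: wl1P => x; exact: cop_linear.
- by exists (bop_norm N T) => xi; exact: lift_fun_bound.
- exact: wl1P.
Qed.

(** As a convolution operator, [lift_op T] has the kernel [T] at the origin and
    0 elsewhere. *)
Definition lift_op (T : bop N) : tcop := Cop (lift_subproof T).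

Lemma lift_linear : linear lift_op.
Proof. by move=> a S T; apply: copP => xi; exact: wl1P. Qed.

Lemma lift_norm T : tcop_norm (lift_op T) <= bop_norm N T.
Proof. by apply: opN_le => [|xi]; [exact: opN_ge0|exact: lift_fun_bound]. Qed.

Lemma liftM S T : lift_op (S * T) = lift_op S * lift_op T.
Proof. by apply: copP => xi; exact: wl1P. Qed.

Lemma lift1 : lift_op 1 = 1.
Proof. by apply: copP => xi; exact: wl1P. Qed.

End WeightedSpace.

(** * Twisted convolution operators *)

Section ComplexSum.
Variables (R : realType) (I : choiceType).

Lemma nsum_approx (f : I -> R) c : (forall i, 0 <= f i) -> sum_le f c ->
  forall e : R, 0 < e -> exists s, uniq s /\
    forall s', uniq s' -> {subset s <= s'} ->
        `|nsum f - \sum_(i <- s') f i| <= e.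
Proof.
move=> f0 fc e e0; have [s [us hs]] := tail_exists fc e0.
exists s; split=> // s' us' ss'.
have h1 : \sum_(i <- s') f i <= nsum f by apply: sum_le_nsum fc _ us'.
rewrite ger0_norm ?subr_ge0// lerBlDr; apply: nsum_le => // t ut.
rewrite (bigID (mem s'))/= addrC lerD//.
  rewrite -big_filter; apply: hs; first exact: filter_uniq.
  by move=> i; rewrite mem_filter => /andP[+ _]; exact/contra/ss'.
rewrite -big_filter; apply: sum_subset_le => //; first exact: filter_uniq.
by move=> i; rewrite mem_filter => /andP[].
Qed.

Lemma rsum_approx (f : I -> R) c : sum_le (fun i => `|f i|) c ->
  forall e : R, 0 < e -> exists s, uniq s /\
    forall s', uniq s' -> {subset s <= s'} ->
        `|rsum f - \sum_(i <- s') f i| <= e.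
Proof.
move=> fc e e0.
have p0 i : 0 <= f^\+ i by exact: funrpos_ge0.
have n0 i : 0 <= f^\- i by exact: funrneg_ge0.
have pn i : f^\+ i + f^\- i = `|f i| by exact: (congr1 (@^~ i) (funrposDneg f)).
have pB i : f^\+ i - f^\- i = f i by exact: (congr1 (@^~ i) (funrposBneg f)).
have pc : sum_le f^\+ c by apply: sum_le_mono fc => i; rewrite -pn lerDl.
have nc : sum_le f^\- c by apply: sum_le_mono fc => i; rewrite -pn lerDr.
have [|s [us hs]] := nsum_approx p0 pc (e := e / 2); first lra.
have [|t [ut ht]] := nsum_approx n0 nc (e := e / 2); first lra.
exists (undup (s ++ t)); split=> [|w uw sw]; first exact: undup_uniq.
have {}hs := hs w uw; have {}ht := ht w uw.
have -> : \sum_(i <- w) f i = \sum_(i <- w) f^\+ i - \sum_(i <- w) f^\- i.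
  by rewrite -sumrB; apply: eq_bigr => i _; rewrite pB.
rewrite /rsum -/(nsum f^\+) -/(nsum f^\-).
have -> : nsum f^\+ - nsum f^\- - (\sum_(i <- w) f^\+ i - \sum_(i <- w) f^\-
    i) =
  (nsum f^\+ - \sum_(i <- w) f^\+ i) - (nsum f^\- - \sum_(i <- w) f^\- i)
      by ring.
apply: le_trans (ler_normB _ _) _; rewrite [e]splitr lerD//.
  by apply: hs => i si; apply: sw; rewrite mem_undup mem_cat si.
by apply: ht => i si; apply: sw; rewrite mem_undup mem_cat si orbT.
Qed.

Lemma csum_has_sum (F : I -> R[i]) c : sum_le (fun i => normc (F i)) c ->
  has_sum (complex_norm R) F (csum F).
Proof.
move=> Fc e e0.
have rc : sum_le (fun i => `|complex.Re (F i)|) c.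
  by apply: sum_le_mono Fc => i; exact: ler_normc_Re.
have ic : sum_le (fun i => `|complex.Im (F i)|) c.
  by apply: sum_le_mono Fc => i; exact: ler_normc_Im.
have [|s [us hs]] := rsum_approx rc (e := e / 2); first lra.
have [|t [ut ht]] := rsum_approx ic (e := e / 2); first lra.
exists (undup (s ++ t)); split=> [|w uw sw]; first exact: undup_uniq.
have {}hs : `|rsum (fun i =>
    complex.Re (F i)) - \sum_(i <- w) complex.Re (F i)| <= e / 2.
  by apply: hs => // i si; apply: sw; rewrite mem_undup mem_cat si.
have {}ht : `|rsum (fun i =>
    complex.Im (F i)) - \sum_(i <- w) complex.Im (F i)| <= e / 2.
  by apply: ht => // i si; apply: sw; rewrite mem_undup mem_cat si orbT.
rewrite -!raddf_sum in hs ht.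
rewrite /= /csum; move: hs ht; set z := \sum_(i <- w) F i.
case: z => a b /= hs ht.
by apply: le_trans (normc_Complex _ _) _; lra.
Qed.

End ComplexSum.

Section TwistedOperators.
Variables (R : realType) (n : nat) (theta : 'M[R[i]]_n).
Hypothesis theta_unit : forall j k, `|theta j k| = 1.
Local Notation G := 'rV[int]_n.
Local Notation sigma := (cocycle theta).
Local Notation H := (ell2 R n).
Local Notation N2 := (@ell2_norm R n).
Local Notation B := (bop N2).
Local Notation BN := (bop_norm N2).

Lemma theta_neq0 j k : theta j k != 0.
Proof. by rewrite -normr_eq0 theta_unit oner_eq0. Qed.

Lemma cocycleDl l l' m : sigma (l + l') m = sigma l m * sigma l' m.
Proof.
rewrite -big_split; apply: eq_bigr => k _; rewrite -big_split;
    apply: eq_bigr => j _.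
by rewrite mxE mulrDl expfzDr ?theta_neq0.
Qed.

Lemma cocycleDr l m m' : sigma l (m + m') = sigma l m * sigma l m'.
Proof.
rewrite -big_split; apply: eq_bigr => k _; rewrite -big_split;
    apply: eq_bigr => j _.
by rewrite mxE mulrDr expfzDr ?theta_neq0.
Qed.

Lemma cocycle0l m : sigma 0 m = 1.
Proof. by rewrite /cocycle big1// => k _; rewrite big1// => j _;
    rewrite mxE mul0r expr0z. Qed.

Lemma cocycle0r l : sigma l 0 = 1.
Proof. by rewrite /cocycle big1// => k _; rewrite big1// => j _;
    rewrite mxE mulr0 expr0z. Qed.

Lemma normc_prod (J : Type) (r : seq J) (P : pred J) (F : J -> R[i]) :
  (forall j, normc (F j) = 1) -> normc (\prod_(j <- r | P j) F j) = 1.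
Proof.
move=> F1; elim/big_rec: _ => [|j z _ z1]; first exact: normc1.
by rewrite normcM F1 z1 mulr1.
Qed.

Lemma normc_exprz (z : R[i]) (k : int) : normc z = 1 -> normc (z ^ k) = 1.
Proof.
move=> z1; case: k => k; first by rewrite -exprnP normcX z1 expr1n.
by rewrite NegzE -exprnN normcV normcX z1 expr1n invr1.
Qed.

Lemma normc_norm (z : R[i]) : `|z| = 1 -> normc z = 1.
Proof. by rewrite normc_def => -[]; case: z. Qed.

Lemma normc_cocycle l m : normc (sigma l m) = 1.
Proof.
apply: normc_prod => k; apply: normc_prod => j.
exact/normc_exprz/normc_norm.
Qed.

Lemma sum_le_mshift (c : G -> R[i]) y (g : H) : (forall x, normc (c x) = 1) ->
  sum_le (fun x => normc (c x * g (x - y)) ^+ 2) (nrm2 g ^+ 2).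
Proof.
move=> c1; apply: sum_le_mono (sum_le_reindex (subrK y) (nrm2_sum g)) => x.
by rewrite normcM c1 mul1r.
Qed.

Section MShift.
Variables (c : G -> R[i]) (c1 : forall x, normc (c x) = 1) (y : G).

Definition mshift_fun (g : H) : H := Ell2 (ell2_intro (sum_le_mshift y g c1)).

Fact mshift_subproof : mshift_fun \in commuting_bounded N2 (no_commutant _).
Proof.
apply/commuting_boundedP; split=> [a g h||[]].
- apply/val_inj/funext => x /=;
    rewrite -[LHS]/(c x * (a * g (x - y) + h (x - y))).
  by rewrite mulrDr mulrCA.
- exists 1 => g; rewrite mul1r; apply: nrm2_le; first exact: nrm2_ge0.
  exact: sum_le_mshift.
Qed.

(** Left and right twisted translations and the unitary operators of
    multiplication by a character are all of this form. *)
Definition mshift : B := Cop mshift_subproof.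

Lemma mshiftE (g : H) x : mshift g x = c x * g (x - y).
Proof. by []. Qed.

Lemma mshift_norm : BN mshift <= 1.
Proof.
apply: opN_le => // g; rewrite mul1r; apply: nrm2_le; first exact: nrm2_ge0.
exact: sum_le_mshift.
Qed.

End MShift.

Lemma ell2P (g h : H) : (forall x, g x = h x) -> g = h.
Proof. by move=> gh; apply/val_inj/funext. Qed.

(** [lsh y] is the regular representation of the point mass at [y]; the right
    translations [rsh p] carry [delta 0] to every [delta p]. *)
Definition lsh y : B := mshift (fun x => normc_cocycle y (x - y)) y.
Definition rsh p : B := mshift (fun x => normc_cocycle (x - p) p) p.

(** The cocycle identity of a bicharacter. *)
Lemma lsh_rsh y p : lsh y * rsh p = rsh p * lsh y.
Proof.
apply: copP => g; apply: ell2P => x; rewrite !cop_mulE !mshiftE.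
rewrite (addrAC x (- p)); set z := x - y - p.
have -> : x - y = z + p by rewrite subrK.
have -> : x - p = z + y by rewrite /z addrAC subrK.
by rewrite cocycleDr cocycleDl; ring.
Qed.

Fact delta_subproof (p : G) : (fun x =>
    (x == p)%:R : R[i]) \in @square_summable R n.
Proof.
apply: (@ell2_intro R n _ 1) => s us.
rewrite (eq_bigr (fun x => (x == p)%:R)); last first.
  by move=> x _; case: eqP; rewrite ?normc1 ?expr1n// normc0 expr0n.
rewrite -natr_sum -[leRHS]/(1%:R) ler_nat.
elim: s us => [|x s IH /= /andP[xs us]]; first by rewrite big_nil.
rewrite big_cons; have [xp|_] := eqVneq x p; last by rewrite add0n IH.
rewrite big_seq big1 ?addn0// => z zs.
by case: eqVneq => // zp; move: xs; rewrite xp -zp zs.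
Qed.

Definition delta (p : G) : H := Ell2 (delta_subproof p).

Lemma deltaE p x : delta p x = (x == p)%:R. Proof. by []. Qed.

Lemma rsh_delta p : rsh p (delta 0) = delta p.
Proof.
apply: ell2P => x; rewrite mshiftE !deltaE subr_eq0.
by case: eqP => [->|_]; rewrite ?mulr0// subrr cocycle0l mulr1.
Qed.

Lemma ell2_sumE (J : Type) (s : seq J) (u : J -> H) x :
  (\sum_(j <- s) u j) x = \sum_(j <- s) u j x.
Proof. by elim/big_rec2: _ => // j a b _ <-. Qed.

Lemma delta_expansion (g : H) : has_sum N2 (fun p => g p *: delta p) g.
Proof.
move=> e e0; have [s [us hs]] := tail_exists (nrm2_sum g) (exprn_gt0 2 e0).
exists s; split=> // s' us' ss'; apply: nrm2_le => [|t ut]; first exact: ltW.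
set k := \sum_(i <- s') _.
have kE x : k x = if x \in s' then g x else 0.
  rewrite /k ell2_sumE; case: ifPn => xs.
    rewrite (big_rem x)//= big_seq big1; last first.
      move=> z; rewrite mem_rem_uniq// inE => /andP[zx _].
      by rewrite -[LHS]/(g z * (x == z)%:R) eq_sym (negbTE zx) mulr0.
    by rewrite addr0 -[LHS]/(g x * (x == x)%:R) eqxx mulr1.
  rewrite big_seq big1// => z zs; rewrite -[LHS]/(g z * (x == z)%:R).
  by case: eqVneq => [xz|]; rewrite ?mulr0//; rewrite xz zs in xs.
rewrite (eq_bigr (fun x => if x \notin s' then normc (g x) ^+ 2 else 0));
    last first.
  move=> x _; rewrite -[(g - k) x]/(g x - k x) kE.
  by case: (x \in s'); rewrite ?subrr ?subr0// normc0 expr0n.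
rewrite -big_mkcond -big_filter; apply: hs; first exact: filter_uniq.
by move=> x; rewrite mem_filter => /andP[+ _]; exact/contra/ss'.
Qed.

(** Finite combinations of the [delta p] are dense. *)
Lemma bop_ext (S T : B) : (forall p, S (delta p) = T (delta p)) -> S = T.
Proof.
move=> ST; apply: copP => g.
have hS (L : B) : has_sum N2 (fun p => g p *: L (delta p)) (L g).
  apply: has_sum_ext (has_sum_map (c := BN L) (cop_linear L) (opN_bound L)
      (delta_expansion g)).
  by move=> p /=; rewrite copZ.
by apply: has_sum_unique (hS S) _; apply: has_sum_ext (hS T) => p; rewrite ST.
Qed.

(** [L] is the regular representation of [f], as a sum in operator norm:
    identities between finite combinations of the [lsh y] then pass to the
    limit. *)
Definition conv_op (f : G -> R[i]) (L : B) : Prop :=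
  has_sum BN (fun y => f y *: lsh y) L.

Lemma conv_op_exists f c : sum_le (fun y => normc (f y)) c ->
    exists L, conv_op f L.
Proof.
move=> fc; apply: (has_sum_exists (c := c)); apply: sum_le_mono fc => y.
rewrite bnormZ -[leRHS]mulr1 ler_wpM2l//; exact: mshift_norm.
Qed.

Lemma ell2_coord_linear x : linear ((fun g : H => g x) : H -> R[i]^o).
Proof. by []. Qed.

Lemma conv_op_coord f L (g : H) x : conv_op f L ->
  has_sum (complex_norm R) (fun y =>
      f y * (sigma y (x - y) * g (x - y))) (L g x).
Proof.
move=> hL.
have lin_ev : linear (fun T : B => T g) by [].
have h1 := has_sum_map (M := N2) (c := N2 g) lin_ev _ hL.
have {}h1 : has_sum N2 (fun y => (f y *: lsh y) g) (L g).
  by apply: h1 => T; rewrite mulrC; exact: (opN_bound T g).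
apply: (has_sum_map (c := 1) (ell2_coord_linear x) _ h1) => h.
by rewrite mul1r; exact: nrm2_coord.
Qed.

(** The terms are absolutely summable both in operator norm and at every
    coordinate, so the operator sum and the pointwise sums agree. *)
Lemma regular_rep_conv f c L (g : H) : sum_le (fun y => normc (f y)) c ->
  conv_op f L -> regular_rep theta f g = L g.
Proof.
move=> fc hL.
have e : twisted_conv theta f g = L g.
  apply/funext => x; apply: has_sum_unique (conv_op_coord g x hL).
  have hc : sum_le (fun y =>
      normc (f y * g (x - y) * sigma y (x - y))) (nrm2 g * c).
    apply: sum_le_mono (sum_leZ (nrm2_ge0 g) fc) => y.
    by rewrite !normcM normc_cocycle mulr1 mulrC ler_wpM2r// nrm2_coord.
  apply: has_sum_ext (csum_has_sum hc) => y; first by ring.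
apply/val_inj; rewrite /regular_rep e val_insubd.
by rewrite (valP (L g)).
Qed.

Lemma conv_op_delta0 f L x : conv_op f L -> L (delta 0) x = f x.
Proof.
move=> hL; apply: has_sum_unique (conv_op_coord (delta 0) x hL) _.
have : has_sum (complex_norm R) (fun y =>
    f y * (sigma y (x - y) * delta 0 (x - y)))
    (\sum_(y <- [:: x]) f y * (sigma y (x - y) * delta 0 (x - y))).
  apply: has_sum_seq => // y; rewrite inE deltaE subr_eq0 eq_sym => /negbTE ->.
  by rewrite !mulr0.
by rewrite big_seq1 deltaE subrr eqxx cocycle0r !mulr1.
Qed.

Lemma conv_op_rsh f L p : conv_op f L -> L * rsh p = rsh p * L.
Proof.
move=> hL; apply: (has_sum_unique (N := BN) (u := fun y =>
    f y *: (lsh y * rsh p))).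
  apply: has_sum_ext (has_sum_map (c := BN (rsh p)) (phi := fun T : B =>
      T * rsh p) _ _ hL).
  - by move=> y /=; rewrite cop_scalerAl.
  - by move=> a S T; rewrite mulrDl cop_scalerAl.
  - by move=> T; rewrite mulrC; exact: opNM.
apply: has_sum_ext (has_sum_map (c := BN (rsh p)) (phi := fun T : B =>
    rsh p * T) _ _ hL).
- by move=> y /=; rewrite lsh_rsh cop_scalerAr.
- by move=> a S T; rewrite mulrDr cop_scalerAr.
- by move=> T; exact: opNM.
Qed.

(** Since the operators of the representation commute with the right
    translations, an identity at the unit vector [delta 0] holds everywhere. *)
Lemma conv_op_inverse f h L M : conv_op f L -> conv_op h M ->
  L (M (delta 0)) = delta 0 -> L * M = 1.
Proof.
move=> hL hM e; apply: bop_ext => p.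
rewrite -rsh_delta -[LHS]/((L * M * rsh p) (delta 0)).
rewrite -mulrA (conv_op_rsh p hM) mulrA (conv_op_rsh p hL).
by rewrite -mulrA !cop_mulE e.
Qed.

End TwistedOperators.

(** * Inverses in the weighted algebra *)

Lemma sum_le_single (R : realType) (I : eqType) (f : I -> R) x0 :
  0 <= f x0 -> (forall x, x != x0 -> f x = 0) -> sum_le f (f x0).
Proof.
move=> f0 fx s us; rewrite (bigID (pred1 x0))/= [X in _ + X]big1 ?addr0//.
rewrite -big_filter; have [xs|xs] := boolP (x0 \in s).
  by rewrite filter_pred1_uniq// big_seq1.
rewrite big_filter big_seq_cond big1// => x /andP[xs' /eqP xx].
by rewrite xx (negbTE xs) in xs'.
Qed.

Lemma rV_int_ind (n : nat) (P : 'rV[int]_n -> Prop) :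
  P 0 -> (forall x y, P x -> P y -> P (x + y)) -> (forall x, P x -> P (- x)) ->
  (forall i, P (delta_mx 0 i)) -> forall x, P x.
Proof.
move=> P0 PD PN Pd x; rewrite [x]row_sum_delta; elim/big_ind: _ => // i _.
have Pn k : P (delta_mx 0 i *+ k).
  by elim: k => [|k IH]; rewrite ?mulr0n// mulrS; exact: PD.
case: (x 0 i) => k; first by rewrite -natz scaler_nat.
by rewrite NegzE scaleNr -natz scaler_nat; exact: PN.
Qed.

Section Wiener.
Variables (R : realType) (n : nat) (theta : 'M[R[i]]_n).
Hypothesis theta_unit : forall j k, `|theta j k| = 1.
Local Notation G := 'rV[int]_n.
Local Notation sigma := (cocycle theta).
Local Notation H := (ell2 R n).
Local Notation N2 := (@ell2_norm R n).
Local Notation B := (bop N2).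
Local Notation BN := (bop_norm N2).
Local Notation lsh := (lsh theta_unit).
Local Notation delta := (@delta R n).
Variable w : weight R G.
Hypothesis w_subexp : forall x (rho e : R), 0 < rho < 1 -> 0 < e ->
  exists k0, forall k, (k0 <= k)%N -> rho ^+ k * w (x *+ k) <= e.
Local Notation A := (tcop w N2).
Local Notation AN := (tcop_norm w N2).
Local Notation iota := (@cop_scalar R (wl1 w N2) (wl1_norm w N2) G
    (@translations R G w H N2)).

Section Gauge.
Variables (c : G -> R[i]) (c1 : forall x, normc (c x) = 1).
Hypothesis cD : forall x y, c (x + y) = c x * c y.

Lemma normc_char_inv x : normc (c x)^-1 = 1.
Proof. by rewrite normcV c1 invr1. Qed.

(** The action of the dual torus: it multiplies the coefficient at [y] by the
    inverse of the character at [y]. *)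
Definition gauge (T : B) : B := mshift normc_char_inv 0 * T * mshift c1 0.

Lemma char_neq0 x : c x != 0.
Proof. by apply: contra_eq_neq (c1 x) => ->;
    rewrite normc0 eq_sym oner_eq0. Qed.

Lemma gaugeM S T : gauge S * gauge T = gauge (S * T).
Proof.
have cc : mshift c1 0 * mshift normc_char_inv 0 = 1.
  apply: copP => g; apply: ell2P => x.
  by rewrite cop_mulE !mshiftE !subr0 mulVKf ?char_neq0.
by rewrite /gauge !mulrA -[X in X * T]mulrA cc mulr1.
Qed.

Lemma gauge1 : gauge 1 = 1.
Proof.
apply: copP => g; apply: ell2P => x.
by rewrite /gauge mulr1 cop_mulE !mshiftE !subr0 mulKf ?char_neq0.
Qed.

Lemma gauge_linear : linear gauge.
Proof.
move=> a S T; rewrite /gauge mulrDr mulrDl; congr (_ + _).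
by rewrite -cop_scalerAr -cop_scalerAl.
Qed.

Lemma gaugeZ a T : gauge (a *: T) = a *: gauge T.
Proof. by rewrite /gauge -cop_scalerAr -cop_scalerAl. Qed.

Lemma gauge_norm T : BN (gauge T) <= 1 * BN T.
Proof.
apply: le_trans (opNM _ _) _; rewrite mul1r -[leRHS]mulr1.
apply: ler_pM; rewrite ?opN_ge0//; last exact: mshift_norm.
apply: le_trans (opNM _ _) _; rewrite -[leRHS]mul1r.
by apply: ler_pM; rewrite ?opN_ge0//; exact: mshift_norm.
Qed.

Lemma gauge_lsh y : gauge (lsh y) = (c y)^-1 *: lsh y.
Proof.
apply: copP => g; apply: ell2P => x.
rewrite /gauge !cop_mulE cop_scaleE !mshiftE -[RHS]/((c y)^-1 * lsh y g x).
rewrite mshiftE !subr0; have -> : c x = c (x - y) * c y by rewrite -cD subrK.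
by field; rewrite !char_neq0.
Qed.

End Gauge.

Lemma iota_norm z (T : A) : AN (iota z * T) <= normc z * AN T.
Proof. by rewrite cop_scalarE; exact: bnormZ_le. Qed.

Lemma trX y k : (tr w N2 y : A) ^+ k = tr w N2 (y *+ k).
Proof.
by elim: k => [|k IH]; rewrite ?expr0 ?tr0// exprS IH mulrS trD.
Qed.

Lemma tr_subexponential y : subexponential AN (tr w N2 y).
Proof.
move=> rho e rho01 e0; have [k0 hk] := w_subexp y rho01 e0.
exists k0 => k /hk; apply: le_trans; rewrite ler_wpM2l ?exprn_ge0//.
  by case/andP: rho01 => /ltW.
by rewrite trX; exact: tr_norm.
Qed.

Variables (f : G -> R[i]) (c : R) (L b : B).
Hypothesis f_sum : sum_le (fun y => normc (f y) * w y) c.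
Hypothesis L_conv : conv_op theta_unit f L.
Hypothesis Lb : L * b = 1.

(** The symbol of [f]: the convolution operator whose coefficient at [y] is the
    operator [f y *: lsh y]. Evaluating it at a character of Z^n gives a gauge
    conjugate of [L]. *)
Definition symbol_term y : A := lift_op w (lsh y) * tr w N2 y.

Lemma symbol_exists : exists F : A, has_sum AN (fun y =>
    f y *: symbol_term y) F.
Proof.
apply: (has_sum_exists (c := c)); apply: sum_le_mono f_sum => y.
rewrite bnormZ ler_wpM2l//; apply: le_trans (opNM _ _) _.
rewrite -[leRHS]mul1r ler_pM ?opN_ge0//; last exact: tr_norm.
apply: le_trans (lift_norm _ _) _; exact: mshift_norm.
Qed.

(** If the symbol generated a proper right ideal, some character of Z^n would
    be defined modulo a larger one. Modulo this ideal the symbol would be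
    arbitrarily close to a gauge conjugate of [L], which is invertible. *)
Lemma symbol_right_inverse F : has_sum AN (fun y => f y *: symbol_term y) F ->
  exists K : A, F * K = 1.
Proof.
move=> hF; apply: contrapT => noK.
pose J (x : A) := exists a, x = F * a.
have Ji : right_ideal J.
  split.
  - by exists 0; rewrite mulr0.
  - by move=> _ _ [a ->] [a' ->]; exists (a + a'); rewrite mulrDr.
  - by move=> _ y [a ->]; exists (a * y); rewrite mulrA.
have J1 : ~ J 1 by move=> [a e]; apply: noK; exists a.
have N_ge0 (x : A) : 0 <= AN x by exact: opN_ge0.
have inv_near1 (x : A) : AN (1 - x) <= 2^-1 -> exists d : A, x * d = 1.
  exact: (cop_inv_near1 (@translations_bounded R G w H N2)).
have units (i : 'I_n) : [/\ central (tr w N2 (delta_mx 0 i)),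
    tr w N2 (delta_mx 0 i) * tr w N2 (- delta_mx 0 i) = 1,
    subexponential AN (tr w N2 (delta_mx 0 i)) &
    subexponential AN (tr w N2 (- delta_mx 0 i))].
  split; [exact: tr_central| |exact: tr_subexponential|exact:
      tr_subexponential].
  by rewrite -trD subrr tr0.
have [z [J' [J'i J'1 JJ' z1 zJ]]] := @joint_spectrum R A AN iota
  (bnormD AN) (bnormN AN) N_ge0 (@opNM _ _ _ _ _) (@opN1 _ _ _ _ _) iota_norm
  (@cop_scalarC _ _ _ _ _) inv_near1 _ _ _ J (enum 'I_n) units Ji J1.
have z0 i : z i != 0.
  by apply: contra_eq_neq (z1 i) => ->; rewrite normc0 eq_sym oner_eq0.
pose ch (y : G) := \prod_(i < n) z i ^ y 0 i.
have ch1 y : normc (ch y) = 1 by apply: normc_prod => i; exact: normc_exprz.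
have chD x y : ch (x + y) = ch x * ch y.
  by rewrite -big_split; apply: eq_bigr => i _; rewrite mxE expfzDr.
have ch_neq0 y := char_neq0 ch1 y.
have ch0 : ch 0 = 1 by rewrite /ch big1// => i _; rewrite mxE expr0z.
have J'ch y : J' (1 - iota (ch y) * tr w N2 y).
  have [J'0 J'D J'M] := J'i.
  elim/rV_int_ind: y => [|x y Jx Jy|x Jx|i].
  - by rewrite ch0 tr0 mulr1 rmorph1 subrr.
  - rewrite chD trD; apply: ideal_scalarM Jx Jy => //; last exact: tr_central.
    exact: cop_scalarC.
  - apply: ideal_scalarV Jx => //; first exact: cop_scalarC.
      by rewrite -chD subrr.
    by rewrite -trD subrr tr0.
  - have -> : ch (delta_mx 0 i) = z i.
      rewrite /ch (bigD1 i)//= big1 ?mulr1; first by rewrite mxE !eqxx expr1z.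
      by move=> j ji; rewrite mxE (negbTE ji) andbF expr0z.
    by apply: zJ; rewrite mem_enum.
have hG : has_sum AN (fun y => lift_op w (gauge ch1 (f y *: lsh y)))
    (lift_op w (gauge ch1 L)).
  apply: (has_sum_map (c := 1) (@lift_linear _ _ w _ N2)).
    by move=> T; rewrite mul1r; exact: lift_norm.
  exact: has_sum_map (gauge_linear ch1) (gauge_norm ch1) L_conv.
have hFN : has_sum AN (fun y => - (f y *: symbol_term y)) (- F).
  apply: (has_sum_map (c := 1) (phi := fun T : A => - T)) hF => [a S T|T].
    by rewrite opprD scalerN.
  by rewrite mul1r bnormN.
have J'term y : J' (lift_op w (gauge ch1 (f y *: lsh y)) - f y *: symbol_term
    y).
  have -> : lift_op w (gauge ch1 (f y *: lsh y)) - f y *: symbol_term y =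
      (1 - iota (ch y) * tr w N2 y) * ((f y * (ch y)^-1) *: lift_op w (lsh y)).
    rewrite gaugeZ (gauge_lsh ch1 chD) scalerA.
    have -> : lift_op w ((f y / ch y) *: lsh y)
        = (f y / ch y) *: lift_op w (lsh y).
      by apply: copP => xi; exact: wl1P.
    rewrite mulrBl mul1r; congr (_ - _).
    rewrite cop_scalarE -cop_scalerAl -cop_scalerAr scalerA mulrC mulfVK//.
    by rewrite tr_central.
  by case: J'i => _ _; apply.
(* A distance [e] from [lift_op (gauge L)] to the ideal becomes, after right
   multiplication by the inverse, a distance at most 1/2 from 1. *)
pose e := (2 * (AN (lift_op w (gauge ch1 b)) + 1))^-1.
have D0 : 0 < 2 * (AN (lift_op w (gauge ch1 b)) + 1).
  by rewrite mulr_gt0// ltr_wpDl.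
have e0 : 0 < e by rewrite invr_gt0.
have [s [us hs]] := has_sumD hG hFN e0.
have near1 : near_ideal AN J' (lift_op w (gauge ch1 L)) e.
  have [_ J'D _] := J'i.
  exists (F + \sum_(y <- s) (lift_op w (gauge ch1 (f y *: lsh y)) - f y *:
      symbol_term y)).
    apply: J'D; last exact: (ideal_sum _ J'i).
    by apply: JJ'; exists 1; rewrite mulr1.
  by rewrite opprD addrA; exact: hs.
have := near_idealM N_ge0 (@opNM _ _ _ _ _) (lift_op w (gauge ch1 b)) J'i near1.
rewrite -liftM gaugeM Lb gauge1 lift1.
apply: (proper_far1 inv_near1 J'i J'1).
rewrite /e -ler_pdivlMl ?invr_gt0// invrK.
have := N_ge0 (lift_op w (gauge ch1 b)); rewrite -/AN; lra.
Qed.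

Fact unit_vector_subproof :
  (fun x : G => if x == 0 then delta 0 else 0) \in wsummable w N2.
Proof.
apply/wsummableP; exists (w 0 * N2 (delta 0)).
have := @sum_le_single R G (fun x =>
    w x * N2 (if x == 0 then delta 0 else 0)) 0.
rewrite eqxx; apply; first by rewrite mulr_ge0 ?wt_ge0 ?bnorm_ge0.
by move=> x /negbTE ->; rewrite bnorm0 mulr0.
Qed.

(** Solving the symbol equation on the vector [delta 0 (x) delta 0] and keeping
    the diagonal coefficients gives a summable function whose operator inverts
    [L]: on the diagonal, the symbol acts as twisted convolution by [f]. *)
Lemma weighted_inverse : b * L = 1 ->
  exists h, (exists d, sum_le (fun y =>
      normc (h y) * w y) d) /\ conv_op theta_unit h b.
Proof.
move=> bL; have [F hF] := symbol_exists; have [K FK] := symbol_right_inverse hF.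
pose eta : wl1 w N2 := WL1 unit_vector_subproof.
pose xi := K eta.
pose h (x : G) := xi x x.
have hsum : sum_le (fun y => normc (h y) * w y) (wl1N xi).
  apply: sum_le_mono (wl1N_sum xi) => y; rewrite mulrC ler_wpM2l ?wt_ge0//.
  exact: nrm2_coord.
have [M hM] : exists M, conv_op theta_unit h M.
  apply: (@conv_op_exists _ _ _ _ _ (wl1N xi)); apply: sum_le_mono hsum => y.
  by rewrite ler_peMr// wt_ge1.
exists h; split; first by exists (wl1N xi).
(* A right inverse of the invertible operator [L] is its inverse [b]. *)
suff LM : L * M = 1.
  by have -> : b = M by rewrite -[b]mulr1 -LM mulrA bL mul1r.
apply: (conv_op_inverse L_conv hM); apply: ell2P => x.
have coord_lin : linear ((fun T : A => T xi x x) : A -> R[i]^o).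
  move=> a S T; rewrite cop_addE cop_scaleE wl1_addE wl1_scaleE.
  by rewrite ell2_addE ell2_scaleE.
have h1 : has_sum (complex_norm R) (fun y =>
    (f y *: symbol_term y) xi x x) (F xi x x).
  apply: (has_sum_map (c := wl1N xi) coord_lin _ hF) => T.
  apply: le_trans (nrm2_coord _ _) _; apply: le_trans (wl1N_coord (T xi) x) _.
  by rewrite mulrC; exact: (opN_bound T xi).
have -> : delta 0 x = F xi x x.
  rewrite -[F xi]/((F * K) eta) FK cop_oneE -[eta x x]/((if x == 0 then delta
      0 else 0) x).
  by case: eqP => // /eqP; rewrite deltaE => /negbTE ->.
apply: has_sum_unique (conv_op_coord (M (delta 0)) x L_conv) _.
apply: has_sum_ext h1 => y; rewrite (conv_op_delta0 _ hM).
by [].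
Qed.

End Wiener.

(** * The GRS-condition as a growth condition *)

Section GrowthRate.
Variables (R : realType) (n : nat) (v : 'rV[int]_n -> R).
Hypothesis v_ge1 : forall x, 1 <= v x.

Lemma powR_invK (a : R) k : 0 <= a -> (0 < k)%N -> (a `^ k%:R^-1) ^+ k = a.
Proof.
move=> a0 k0; rewrite -powR_mulrn ?powR_ge0// -powRrM mulVf ?powRr1//.
by rewrite pnatr_eq0 -lt0n.
Qed.

Lemma GRS_subexponential : GRS_condition v ->
  forall x (rho e : R), 0 < rho < 1 -> 0 < e ->
  exists k0, forall k, (k0 <= k)%N -> rho ^+ k * v (x *+ k) <= e.
Proof.
move=> grs x rho e /andP[r0 r1] e0.
pose d := (rho^-1 - 1) / 2.
have rV : 1 < rho^-1 by rewrite invf_gt1.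
have d0 : 0 < d by rewrite divr_gt0// subr_gt0.
have q1 : 0 <= (1 + d) * rho < 1.
  rewrite mulr_ge0 ?addr_ge0 ?ltW//=.
  have : rho^-1 * rho = 1 by rewrite mulVf ?gt_eqF.
  by rewrite /d; nra.
have [k1 hk1] := pow_small q1 e0.
have [k2 _ hk2] := (cvgrPdist_le _ _).1 (grs x) d d0.
exists (maxn 1 (maxn k1 k2)) => k; rewrite !geq_max => /and3P[k0 kk1 kk2].
apply: le_trans (hk1 k kk1);
    rewrite exprMn mulrC ler_wpM2r ?exprn_ge0 ?(ltW r0)//.
have := hk2 k kk2; rewrite distrC => /(le_trans (ler_norm _));
    rewrite lerBlDl => h.
rewrite -[leLHS](@powR_invK _ k)//; last by rewrite (le_trans ler01).
by rewrite lerXn2r ?nnegrE ?powR_ge0// addr_ge0// ltW.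
Qed.

Lemma GRS_of_bounds :
  (forall x (r : R), 0 < r < 1 ->
      exists c, forall k, r ^+ k * v (x *+ k) <= c) ->
  GRS_condition v.
Proof.
move=> hv x; apply/cvgrPdist_le => e e0.
pose r := (1 + e / 2)^-1.
have e2 : 0 < 1 + e / 2 by rewrite addr_gt0// divr_gt0.
have r01 : 0 < r < 1 by rewrite invr_gt0 e2 invf_lt1// ltrDl divr_gt0.
have [c hc] := hv x r r01; have [r0 r1] := andP r01.
have e1 : 0 < 1 + e by rewrite addr_gt0.
have q01 : 0 <= (1 + e / 2) / (1 + e) < 1.
  by rewrite divr_ge0 ?ltW//= ltr_pdivrMr// mul1r ltrD2l gtr_pMr// invf_lt1//
      ltr1n.
have c1 : 0 < `|c| + 1 by rewrite ltr_wpDl.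
have [k1 hk1] := pow_small q01 (divr_gt0 ltr01 c1).
exists (maxn 1 k1) => // k; rewrite /= geq_max => /andP[k0 kk1].
have v1 := v_ge1 (x *+ k); have v0 : 0 <= v (x *+ k) by exact: le_trans v1.
rewrite ler_norml; apply/andP; split.
  suff : v (x *+ k) `^ k%:R^-1 <= 1 + e by lra.
  rewrite -(@ler_pXn2r _ k)// ?nnegrE ?powR_ge0 ?(ltW e1)// powR_invK//.
  have hq := hk1 k kk1.
  have : r ^+ k * v (x *+ k) <= `|c| + 1.
    by apply: le_trans (hc k) _; rewrite (le_trans (ler_norm c))// lerDl.
  rewrite /r exprVn ler_pdivrMl ?exprn_gt0// => /le_trans; apply.
  move: hq; rewrite exprMn exprVn ler_pdivrMr ?exprn_gt0// mul1r.
  by rewrite ler_pdivlMl// mulrC.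
suff : 1 <= v (x *+ k) `^ k%:R^-1 by lra.
rewrite -(@ler_pXn2r _ k)// ?nnegrE ?powR_ge0// powR_invK// expr1n//.
Qed.

End GrowthRate.

Section Reindexing.
Variables (I J : choiceType) (phi : I -> J).
Hypothesis phi_inj : injective phi.

Lemma preimage_seq (s : seq J) : exists t : seq I,
  uniq t /\ forall i, (i \in t) = (phi i \in s).
Proof.
elim: s => [|y s [t [ut ht]]]; first by exists [::].
have [[i iy]|ny] := pselect (exists i, phi i = y); last first.
  exists t; split=> // i; rewrite inE ht; case: eqP => // e.
  by case: ny; exists i.
exists (undup (i :: t)); split=> [|j]; first exact: undup_uniq.
by rewrite mem_undup !inE ht -iy (inj_eq phi_inj).
Qed.

Lemma big_preimage (V : nmodType) (F : J -> V) (s : seq J) (t : seq I) :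
  (forall y, (forall i, phi i <> y) -> F y = 0) -> uniq s -> uniq t ->
  (forall i, (i \in t) = (phi i \in s)) ->
  \sum_(y <- s) F y = \sum_(i <- t) F (phi i).
Proof.
move=> F0 us ut ht;
    rewrite (bigID (mem (map phi t)))/= [X in _ + X]big_seq_cond.
rewrite [X in _ + X]big1 ?addr0 => [|y /andP[ys yt]]; last first.
  by apply: F0 => i iy; case/negP: yt; rewrite -iy map_f// ht iy.
rewrite -big_filter -(big_map phi xpredT F); apply/perm_big/uniq_perm.
- exact: filter_uniq.
- by rewrite map_inj_uniq.
- move=> y; rewrite mem_filter;
    case: (boolP (y \in map phi t)) => //= /mapP[i it ->].
  by rewrite -ht it.
Qed.

Lemma sum_le_inj (R : realType) (F : J -> R) c :
  (forall y, (forall i, phi i <> y) -> F y = 0) ->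
  sum_le (fun i => F (phi i)) c -> sum_le F c.
Proof.
move=> F0 hc s us; have [t [ut ht]] := preimage_seq s.
by rewrite (big_preimage F0 us ut ht); exact: hc.
Qed.

Lemma has_sum_inj (R : realType) (V : lmodType R[i]) (N : banach_norm V)
    (F : J -> V) x :
  (forall y, (forall i, phi i <> y) -> F y = 0) ->
  has_sum N (fun i => F (phi i)) x -> has_sum N F x.
Proof.
move=> F0 hx e e0; have [t0 [ut0 h]] := hx e e0.
exists (map phi t0); split=> [|s us ss]; first by rewrite map_inj_uniq.
have [t [ut ht]] := preimage_seq s.
rewrite (big_preimage F0 us ut ht); apply: h => // i it.
by rewrite ht ss// map_f.
Qed.

End Reindexing.

(** * The two algebras and the converse implication *)

Section Converse.
Variables (R : realType) (n : nat) (theta : 'M[R[i]]_n).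
Hypothesis theta_unit : forall j k, `|theta j k| = 1.
Local Notation G := 'rV[int]_n.
Local Notation H := (ell2 R n).
Local Notation N2 := (@ell2_norm R n).
Local Notation B := (bop N2).
Local Notation BN := (bop_norm N2).
Local Notation lsh := (lsh theta_unit).
Local Notation delta := (@delta R n).

Lemma nrm2Z a (g : H) : nrm2 (a *: g) = normc a * nrm2 g.
Proof. exact: (bnormZ N2). Qed.

Lemma nrm20 : nrm2 (0 : H) = 0. Proof. exact: (bnorm0 N2). Qed.

(** A finite operator norm bounds T on the unit ball; homogeneity does the
    rest. *)
Lemma bounded_operators_bop (T : H -> H) : bounded_operators T ->
  exists S : B, T = S.
Proof.
move=> [lT oT].
pose lTb := GRing.isLinear.Build _ _ _ _ T lT.
pose TL : {linear H -> H} := HB.pack T lTb.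
have T0 : T 0 = 0 by exact: (linear0 TL).
have TZ a g : T (a *: g) = a *: T g by exact: (linearZZ TL).
have o0 : (0 <= opnorm T)%E.
  apply: ereal_sup_ubound; exists 0; last by rewrite T0 l2normE nrm20.
  by change (is_true (l2norm (0%R : H) <= 1)%E); rewrite l2normE nrm20 lee_fin.
have bT g : nrm2 g <= 1 -> nrm2 (T g) <= fine (opnorm T).
  move=> g1; rewrite -lee_fin fineK ?ge0_fin_numE// -l2normE.
  by apply: ereal_sup_ubound; exists g => //=; rewrite l2normE lee_fin.
have TP : T \in commuting_bounded N2 (no_commutant _).
  apply/commuting_boundedP; split=> [//||[]].
  exists (fine (opnorm T)) => g.
  have [/nrm2_le0 ->|g0] := leP (nrm2 g) 0; first by rewrite T0 bnorm0 mulr0.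
  pose a : R[i] := ((nrm2 g)^-1%:C)%C.
  have na : normc a = (nrm2 g)^-1 by rewrite normc_real gtr0_norm ?invr_gt0.
  have := bT (a *: g); rewrite TZ !nrm2Z na mulVf ?gt_eqF// => /(_ (lexx _)).
  by rewrite ler_pdivrMl// mulrC.
by exists (Cop TP).
Qed.

Lemma opnorm_le (T : H -> H) c : 0 <= c ->
  (forall g, nrm2 (T g) <= c * nrm2 g) -> (opnorm T <= c%:E)%E.
Proof.
move=> c0 hT; apply: ge_ereal_sup => _ [g g1 <-].
have {}g1 : nrm2 g <= 1 by rewrite -lee_fin -l2normE.
rewrite l2normE lee_fin.
by apply: le_trans (hT g) _; rewrite ler_piMr.
Qed.

Lemma bop_bounded_operators (S : B) : bounded_operators S.
Proof.
split; first exact: cop_linear.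
exact: le_lt_trans (opnorm_le (opN_ge0 S) (opN_bound S)) (ltry _).
Qed.

Lemma conv_op_nc_torus f c (L : B) : sum_le (fun y => normc (f y)) c ->
  conv_op theta_unit f L -> nc_torus theta L.
Proof.
move=> fc hL; split; first exact: bop_bounded_operators.
move=> e e0; exists f; first exact: sum_le_ltoo fc.
apply: (@le_lt_trans _ _ 0%:E); last by rewrite lte_fin.
apply: opnorm_le => // g /=.
by rewrite (regular_rep_conv g fc hL) subrr mul0r nrm20.
Qed.

Lemma lshM y z : lsh y * lsh z = cocycle theta y z *: lsh (y + z).
Proof.
apply: copP => g; apply: ell2P => x;
    rewrite cop_mulE cop_scaleE ell2_scaleE !mshiftE.
rewrite opprD addrA; set u := x - y - z.
have -> : x - y = z + u by rewrite [RHS]addrC subrK.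
by rewrite (cocycleDr theta_unit) (cocycleDl theta_unit); ring.
Qed.

Lemma lsh0 : lsh 0 = 1.
Proof.
by apply: copP => g; apply: ell2P => x; rewrite mshiftE subr0 cocycle0l mul1r.
Qed.

Lemma lshX x k : exists p, normc p = 1 /\ lsh x ^+ k = p *: lsh (x *+ k).
Proof.
elim: k => [|k [p [p1 IH]]].
  by exists 1; rewrite normc1 expr0 mulr0n lsh0 scale1r.
exists (p * cocycle theta x (x *+ k)).
rewrite normcM p1 mul1r normc_cocycle//; split=> //.
by rewrite exprS IH -cop_scalerAr lshM scalerA mulrS.
Qed.

Lemma sum_le_geometric (r : R) : 0 <= r < 1 ->
    sum_le (fun k => r ^+ k) (1 - r)^-1.
Proof.
move=> /andP[r0 r1] s us.
have p0 k : 0 <= r ^+ k by exact: exprn_ge0.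
pose M := (\max_(k <- s) k).+1.
apply: (@le_trans _ _ (\sum_(k <- iota 0 M) r ^+ k)).
  apply: sum_subset_le => //; first exact: iota_uniq.
  by move=> k ks; rewrite mem_iota/= add0n ltnS; exact: leq_bigmax_seq.
rewrite -[(1 - r)^-1]mul1r ler_pdivlMr ?subr_gt0//.
have : \sum_(k <- iota 0 M) r ^+ k = \sum_(k < M) r ^+ k.
  by rewrite -[in LHS](subn0 M) -/(index_iota 0 M) big_mkord.
move=> ->; have := subrX1 r M; rewrite mulrC => e.
have : (\sum_(k < M) r ^+ k) * (1 - r) = 1 - r ^+ M.
  by rewrite -[1 - r]opprB mulrN -e opprB.
by move=> ->; rewrite gerBl.
Qed.

Lemma neumann (T : B) (r : R) : 0 <= r < 1 ->
    (forall k, BN (T ^+ k) <= r ^+ k) ->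
  exists S : B, [/\ has_sum BN (fun k =>
      T ^+ k) S, (1 - T) * S = 1 & S * (1 - T) = 1].
Proof.
move=> r01 hT.
have [S hS] : exists S, has_sum BN (fun k => T ^+ k) S.
  by apply: has_sum_exists; apply: sum_le_mono (sum_le_geometric r01).
pose W M := \sum_(i < M) T ^+ i.
have W1 M : (1 - T) * W M = 1 - T ^+ M by rewrite -opprB mulNr -subrX1 opprB.
have W2 M : W M * (1 - T) = 1 - T ^+ M.
  by rewrite -W1; apply/esym/commr_sum => i _;
      apply/commrX/commr_sym/commrB => //; exact: commr1.
have near (e : R) : 0 < e -> exists M, BN (S - W M) <= e /\ BN (T ^+ M) <= e.
  move=> e0; have [s [us hs]] := hS e e0; have [k0 hk0] := pow_small r01 e0.
  pose M := maxn k0 (\max_(k <- s) k).+1; exists M; split; last first.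
    by apply: le_trans (hT M) (hk0 M _); exact: leq_maxl.
  have -> : W M = \sum_(k <- iota 0 M) T ^+ k.
    by rewrite -[in RHS](subn0 M) -/(index_iota 0 M) big_mkord.
  apply: hs; first exact: iota_uniq.
  move=> k ks; rewrite mem_iota/= add0n (leq_trans _ (leq_maxr _ _))// ltnS.
  exact: leq_bigmax_seq.
have D0 : 0 < BN (1 - T) + 1 by rewrite ltr_wpDl// opN_ge0.
have fin (e : R) : 0 < e ->
    exists M, BN (S - W M) * BN (1 - T) + BN (T ^+ M) <= e.
  move=> e0; have [M [h1 h2]] := near _ (divr_gt0 e0 D0); exists M.
  have h3 : BN (S - W M) * BN (1 - T) <= e / (BN (1 - T) + 1) * BN (1 - T).
    by rewrite ler_wpM2r// opN_ge0.
  have : e / (BN (1 - T) + 1) * (BN (1 - T) + 1) = e by rewrite divfK ?gt_eqF.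
  by rewrite mulrDr mulr1; lra.
exists S; split=> //; apply: (@bnorm_eq _ _ BN) => e /fin[M]; apply: le_trans.
  have -> : (1 - T) * S - 1 = (1 - T) * (S - W M) - T ^+ M.
    by rewrite mulrBr W1 opprB -addrA [_ - 1 - _]addrAC subrr add0r.
  by apply: le_trans (bnormB _ _ _) _; rewrite lerD2r mulrC; exact: opNM.
have -> : S * (1 - T) - 1 = (S - W M) * (1 - T) - T ^+ M.
  by rewrite mulrBl W2 opprB -addrA [_ - 1 - _]addrAC subrr add0r.
by apply: le_trans (bnormB _ _ _) _; rewrite lerD2r; exact: opNM.
Qed.

Variable v : G -> R.
Hypothesis v_ge1 : forall x, 1 <= v x.

Lemma weighted_ell1P f : weighted_ell1 v f <->
  exists c, sum_le (fun x => normc (f x) * v x) c.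
Proof.
split=> [hf|[c hc]]; last exact: sum_le_ltoo hc.
exists (fine (\esum_(x in [set: G]) (normc (f x) * v x)%:E)).
by apply: sum_le_fine => // x; rewrite mulr_ge0// (le_trans ler01).
Qed.

Lemma weighted_sum_le f c : sum_le (fun x => normc (f x) * v x) c ->
  sum_le (fun x => normc (f x)) c.
Proof. by apply: sum_le_mono => x; rewrite ler_peMr. Qed.

(** The inverse of 1 - r lsh x is given by its Neumann series, whose
    coefficient at kx has modulus r^k. *)
Lemma inverse_closed_bound : inverse_closed (weighted_torus theta v) (nc_torus
    theta) ->
  forall x (r : R), 0 < r < 1 -> exists c, forall k, r ^+ k * v (x *+ k) <= c.
Proof.
move=> ic x r /andP[r0 r1].
have v0 y : 0 <= v y by exact: le_trans (v_ge1 y).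
have [->|x0] := eqVneq x 0.
  exists (v 0) => k; rewrite mul0rn -[leRHS]mul1r ler_wpM2r//.
  by rewrite exprn_ile1// ltW.
have phi_inj : injective (fun k => x *+ k).
  have [j xj] : exists j, x 0 j != 0.
    apply: contrapT => h; case/eqP: x0; apply/rowP => j; rewrite mxE; apply/eqP.
    by apply: contrapT => /negP xj; apply: h; exists j.
  move=> k m /= /(congr1 (fun y : G => y 0 j)); rewrite !mulmxnE.
  exact: mulrIn.
have r01 : 0 <= r < 1 by rewrite ltW.
pose T : B := (r%:C)%C *: lsh x.
have nr : normc (r%:C)%C = r by rewrite normc_real gtr0_norm.
have /choice[p hp] k := lshX x k.
have TX k : T ^+ k = ((r%:C)%C ^+ k * p k) *: lsh (x *+ k).
  have -> : T ^+ k = (r%:C)%C ^+ k *: lsh x ^+ k.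
    elim: k => [|k IH]; first by rewrite !expr0 scale1r.
    by rewrite !exprS IH /T -cop_scalerAl -cop_scalerAr scalerA.
  by have [_ ->] := hp k; rewrite scalerA.
have na k : normc ((r%:C)%C ^+ k * p k) = r ^+ k.
  by have [p1 _] := hp k; rewrite normcM normcX nr p1 mulr1.
have TN k : BN (T ^+ k) <= r ^+ k.
  rewrite TX bnormZ na -[leRHS]mulr1 ler_wpM2l ?exprn_ge0 ?(ltW r0)//.
  exact: mshift_norm.
have [S [hS TS ST]] := neumann r01 TN.
have [h hh] : exists h : G -> R[i], forall y,
    (forall k, y = x *+ k -> h y = (r%:C)%C ^+ k * p k) /\
    ((forall k, x *+ k <> y) -> h y = 0).
  suff /choice[h hh] : forall y, exists z, (forall k, y = x *+ k ->
      z = (r%:C)%C ^+ k * p k) /\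
     ((forall k, x *+ k <> y) -> z = 0) by exists h.
  move=> y; have [[k yk]|ny] := pselect (exists k, x *+ k = y).
    exists ((r%:C)%C ^+ k * p k); split=> [m ym|/(_ k)//].
    by have -> : k = m by apply: phi_inj; rewrite /= yk.
  by exists 0; split=> // k yk; case: ny; exists k.
have hk k : h (x *+ k) = (r%:C)%C ^+ k * p k by have [e _] := hh (x *+ k);
    exact: e.
have h0 y : (forall k, x *+ k <> y) -> h y = 0 by have [_ e] := hh y.
have hsum : sum_le (fun y => normc (h y)) (1 - r)^-1.
  apply: (sum_le_inj phi_inj) => [y /h0 ->|]; first exact: normc0.
  by apply: sum_le_mono (sum_le_geometric r01) => k; rewrite hk na.
have Sconv : conv_op theta_unit h S.
  apply: (has_sum_inj phi_inj) => [y /h0 ->|]; first by rewrite scale0r.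
  by apply: has_sum_ext hS => k; rewrite TX hk.
pose f (y : G) : R[i] := if y == 0 then 1 else if y == x then - (r%:C)%C else 0.
have u0x : uniq [:: 0; x] by rewrite /= inE eq_sym x0.
have f_out y : y \notin [:: 0; x] -> f y = 0.
  by rewrite !inE negb_or => /andP[/negbTE y0 /negbTE yx]; rewrite /f y0 yx.
have Lconv : conv_op theta_unit f (1 - T).
  have -> : 1 - T = \sum_(y <- [:: 0; x]) f y *: lsh y.
    by rewrite !big_cons big_nil addr0 /f eqxx (negbTE x0) eqxx scale1r lsh0
        scaleNr.
  by apply: has_sum_seq => // y /f_out ->; rewrite scale0r.
have fv : sum_le (fun y => normc (f y) * v y) (v 0 + r * v x).
  have h1 := @sum_le_single R G (fun y => if y == 0 then v 0 else 0) 0.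
  have h2 := @sum_le_single R G (fun y => if y == x then r * v x else 0) x.
  rewrite eqxx in h1; rewrite eqxx in h2.
  have {}h1 := h1 (v0 0) (fun y => @ifN_eq _ _ _ _ _ _).
  have {}h2 := h2 (mulr_ge0 (ltW r0) (v0 x)) (fun y => @ifN_eq _ _ _ _ _ _).
  apply: sum_le_mono (sum_leD h1 h2) => y; rewrite /f.
  have [->|y0] := eqVneq y 0; first by rewrite normc1 mul1r lerDl;
      case: ifP => // _; rewrite mulr_ge0// ltW.
  by have [->|_] := eqVneq y x; rewrite ?normcN ?nr ?normc0 ?mul0r add0r.
have repL : regular_rep theta f = 1 - T.
  by apply/funext => g; exact: regular_rep_conv (weighted_sum_le fv) Lconv.
have [h' /weighted_ell1P[c' hc'] e'] : weighted_torus theta v S.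
  apply: (ic (1 - T : B) S).
  - by exists f => //; apply/weighted_ell1P; exists (v 0 + r * v x).
  - exact: conv_op_nc_torus hsum Sconv.
  - by apply/funext => g; rewrite /comp -cop_mulE TS.
  - by apply/funext => g; rewrite /comp -cop_mulE ST.
have [L' hL'] := conv_op_exists theta_unit (weighted_sum_le hc').
have L'S : L' = S.
  by apply: copP => g;
      rewrite -e' (regular_rep_conv g (weighted_sum_le hc') hL').
exists c' => k.
have hh' : h' (x *+ k) = (r%:C)%C ^+ k * p k.
  by rewrite -hk -(conv_op_delta0 _ hL') -(conv_op_delta0 _ Sconv) L'S.
by have := sum_le_term (x *+ k) hc'; rewrite hh' na.
Qed.

End Converse.

Theorem proposition5 (R : realType) (n : nat) (n_ge1 : (1 <= n)%N)
    (theta : 'M[R[i]]_n)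
    (theta_unit : forall j k, `|theta j k| = 1)
    (theta_conj : forall j k, theta k j = ((theta j k)^*)%C)
    (theta_diag : forall j, theta j j = 1)
    (v : 'rV[int]_n -> R)
    (v_gt0 : forall x, 0 < v x)
    (v_submul : forall x y, v (x + y) <= v x * v y)
    (v_sym : forall x, v (- x) = v x) :
  inverse_closed (weighted_torus theta v) (nc_torus theta) <-> GRS_condition v.
Proof.
have v1 x : 1 <= v x.
  have v01 : 1 <= v 0.
    by have := v_submul 0 0; rewrite addr0 -{1}[v 0]mulr1 ler_pM2l.
  rewrite -(@ler_pXn2r _ 2)// ?nnegrE ?(ltW (v_gt0 x))// expr1n.
  by apply: le_trans v01 _; rewrite -{1}(subrr x) expr2 -{2}(v_sym x).
split=> [ic|grs].
  apply: (GRS_of_bounds v1) => x r.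
  exact: (@inverse_closed_bound R n theta theta_unit v v1 ic x r).
pose w : weight R 'rV[int]_n := Weight v1 v_submul.
move=> a b [f /(weighted_ell1P v1)[c fc] fa] [/bounded_operators_bop[S ->] _]
    aS Sa.
have fc1 := weighted_sum_le v1 fc.
have [L hL] := conv_op_exists theta_unit fc1.
have aL : a = L by rewrite -fa; apply/funext => g;
    exact: regular_rep_conv fc1 hL.
have LS : L * S = 1 by apply: copP => g; move/(congr1 (@^~ g)): aS; rewrite aL.
have SL : S * L = 1 by apply: copP => g; move/(congr1 (@^~ g)): Sa; rewrite aL.
have [h [[d hd] hS]] := @weighted_inverse R n theta theta_unit w
  (GRS_subexponential v1 grs) f c L S fc hL LS SL.
exists h; first by apply/(weighted_ell1P v1); exists d.
by apply/funext => g; exact: regular_rep_conv (weighted_sum_le v1 hd) hS.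
Qed.
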